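(* Let $\mu$ and $\nu$ be two positive and finite Borel measures on $\mathbb{C}$, each having compact and infinite support and satisfying $$\liminf_{n\to\infty}\frac{\kappa_n(\mu)}{\kappa_{n+1}(\mu)}>0,\qquad \liminf_{n\to\infty}\frac{\kappa_n(\nu)}{\kappa_{n+1}(\nu)}>0.\qquad( * )$$ Let $\mathcal{N}(\mu)=\{n_k\}_{k=1}^{\infty}\subseteq\mathbb{N}$ and $\mathcal{N}(\nu)=\{m_k\}_{k=1}^{\infty}\subseteq\mathbb{N}$ be two subsequences. The following statements are equivalent: (i) The measures $\mu$ and $\nu$ exhibit normalized relative ratio asymptotics through $\mathcal{N}(\mu)$ and $\mathcal{N}(\nu)$. (ii) For every subsequence $\mathcal{N}^*\subseteq\mathbb{N}$ and every bi-infinite matrix $X$: $M_{\mu}$ approaches the right limit $X$ through $\{n_k\}_{k\in\mathcal{N}^*}$ if and only if $M_{\nu}$ approaches $X$ through $\{m_k\}_{k\in\mathcal{N}^*}$. In particular, the measures $\mu$ and $\nu$ exhibit normalized relative ratio asymptotics if and only if the unique right limit of $M_{\mu}-M_{\nu}$ is $0$. The implication (ii) $\Rightarrow$ (i) is valid even if condition $( * )$ is not satisfied.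
   Context: For a finite positive measure $\mu$ on $\mathbb{C}$ with compact and infinite support, $\{p_n(z;\mu)\}_{n\ge0}$ denotes the sequence of orthonormal polynomials: $p_n(\cdot;\mu)$ has degree $n$, positive leading coefficient $\kappa_n(\mu)>0$, and $\int p_n\overline{p_m}\,d\mu=\delta_{m,n}$. Set $R_\mu=\sup\{|z|:z\in\mathrm{supp}(\mu)\}$. The Bergman Shift matrix $M_\mu$ is the matrix of multiplication by $z$ on the closure of the polynomials in $L^2(\mu)$ in the orthonormal basis $\{p_n\}_{n\ge0}$; its rows and columns are indexed by $\{1,2,3,\ldots\}$, with $(M_\mu)_{i,k}=\int z\,p_{k-1}(z;\mu)\overline{p_{i-1}(z;\mu)}\,d\mu(z)$. Subsequences of $\mathbb{N}$ are infinite and strictly increasing. The measures $\mu$ and $\nu$ exhibit normalized relative ratio asymptotics through $\mathcal{N}(\mu)=\{n_k\}$ and $\mathcal{N}(\nu)=\{m_k\}$ if $$\lim_{k\to\infty}\left(\frac{p_{n_k+j-1}(z;\mu)}{p_{n_k+j}(z;\mu)}-\frac{p_{m_k+j-1}(z;\nu)}{p_{m_k+j}(z;\nu)}\right)=0\quad\text{for all } |z|>\max\{R_{\mu},R_{\nu}\}\text{ and all } j\in\mathbb{Z}.$$ If $\mathcal{N}(\mu)=\mathcal{N}(\nu)=\mathbb{N}$, one simply says that $\mu$ and $\nu$ exhibit normalized relative ratio asymptotics. For a matrix $A$ with rows and columns indexed by $\mathbb{N}$, $A_n^{(m)}$ is the $(2m+1)\times(2m+1)$ submatrix of $A$ centered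 at $A_{n,n}$ (defined for $n>m$). A bi-infinite matrix $X$ (indexed by $\mathbb{Z}$) is a right limit of $A$, and $A$ approaches $X$ through the subsequence $\mathcal{N}\subseteq\mathbb{N}$, if for every $m\in\mathbb{N}$, $\lim_{n\to\infty,\,n\in\mathcal{N}}A_n^{(m)}=X_0^{(m)}$, where $X_0^{(m)}$ is the $(2m+1)\times(2m+1)$ submatrix of $X$ centered at $X_{0,0}$. *)

(* Defs.v *)
From HB Require Import structures.
From mathcomp Require Import all_boot all_order all_algebra.
From mathcomp Require Import all_classical all_reals all_analysis.
From mathcomp Require Import complex.

Set Implicit Arguments.
Unset Strict Implicit.
Unset Printing Implicit Defensive.

Import Order.TTheory GRing.Theory Num.Theory numFieldNormedType.Exports.

Local Open Scope classical_set_scope.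
Local Open Scope ring_scope.

(* Packing R[i] as a numClosedFieldType gives it its norm topology; the bare
   type R[i] carries none. *)
Definition Cplx (R : realType) : numClosedFieldType := R[i].

Definition BorelC (R : realType) := g_sigma_algebraType (@open (Cplx R)).

(* Same function as `|z|, but with values in R. *)
Definition cabs (R : realType) (z : Cplx R) : R := ComplexField.Normc.normc z.

Definition cintegral (R : realType) (mu : {finite_measure set BorelC R -> \bar R})
    (f : Cplx R -> Cplx R) : Cplx R :=
  ((\int[mu]_z complex.Re (f z)) +i* (\int[mu]_z complex.Im (f z)))%C.

Definition msupp (R : realType) (mu : {finite_measure set BorelC R -> \bar R}) :
    set (Cplx R) :=
  [set z | forall U : set (Cplx R), open U -> U z -> (0 < mu U)%E].

Definition mradius (R : realType) (mu : {finite_measure set BorelC R -> \bar R}) : R :=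
  sup [set cabs z | z in msupp mu].

(* In R[i], [0 < c] means that c is real and positive. *)
Definition orthonormal_polys (R : realType)
    (mu : {finite_measure set BorelC R -> \bar R}) (p : nat -> {poly Cplx R}) : Prop :=
  (forall n, size (p n) = n.+1 /\ 0 < lead_coef (p n)) /\
  (forall n m, cintegral mu (fun z => (p n).[z] * ((p m).[z])^*) = (m == n)%:R).

Definition kappa (R : realType) (p : nat -> {poly Cplx R}) (n : nat) : R :=
  complex.Re (lead_coef (p n)).

Definition kappa_ratio_liminf_pos (R : realType) (p : nat -> {poly Cplx R}) : Prop :=
  (0 < limn_einf (fun n => (kappa p n / kappa p n.+1)%:E))%E.

(* Rows and columns are numbered from 1; row and column 0 are never used. *)
Definition bergman_shift (R : realType)
    (mu : {finite_measure set BorelC R -> \bar R}) (p : nat -> {poly Cplx R})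
    (i k : nat) : Cplx R :=
  cintegral mu (fun z => z * (p k.-1).[z] * ((p i.-1).[z])^*).

Definition strictly_increasing (n : nat -> nat) : Prop :=
  {homo n : a b / (a < b)%N}.

(* Polynomials of negative index are set to 0: with n_k -> oo, only finitely
   many k are affected for each j. *)
Definition zpoly (R : realType) (p : nat -> {poly Cplx R}) (i : int) : {poly Cplx R} :=
  if i is Posz n then p n else 0.

Definition ratio_asymptotics_through (R : realType)
    (mu nu : {finite_measure set BorelC R -> \bar R}) (p q : nat -> {poly Cplx R})
    (n m : nat -> nat) : Prop :=
  forall z : Cplx R, Num.max (mradius mu) (mradius nu) < cabs z ->
  forall j : int,
    (fun k : nat =>
       (zpoly p ((n k)%:Z + j - 1)).[z] / (zpoly p ((n k)%:Z + j)).[z]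
       - (zpoly q ((m k)%:Z + j - 1)).[z] / (zpoly q ((m k)%:Z + j)).[z])
    @ \oo --> (0 : Cplx R).

Definition ratio_asymptotics (R : realType)
    (mu nu : {finite_measure set BorelC R -> \bar R}) (p q : nat -> {poly Cplx R}) : Prop :=
  ratio_asymptotics_through mu nu p q id id.

(* Row (column) i of the block is row (column) n - m + i of A; meaningful for
   m < n. *)
Definition central_block (R : realType) (A : nat -> nat -> Cplx R) (n m : nat) :
    'M[Cplx R]_(m.*2.+1) :=
  \matrix_(i, j) A (n + i - m)%N (n + j - m)%N.

Definition bi_central_block (R : realType) (X : int -> int -> Cplx R) (m : nat) :
    'M[Cplx R]_(m.*2.+1) :=
  \matrix_(i, j) X (i%:Z - m%:Z) (j%:Z - m%:Z).

Definition approaches (R : realType) (A : nat -> nat -> Cplx R)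
    (X : int -> int -> Cplx R) (n : nat -> nat) : Prop :=
  forall m : nat,
    (fun k : nat => central_block A (n k) m) @ \oo --> bi_central_block X m.

Definition right_limit (R : realType) (A : nat -> nat -> Cplx R)
    (X : int -> int -> Cplx R) : Prop :=
  exists2 n : nat -> nat, strictly_increasing n & approaches A X n.

Definition same_right_limits_through (R : realType) (A B : nat -> nat -> Cplx R)
    (n m : nat -> nat) : Prop :=
  forall s : nat -> nat, strictly_increasing s ->
  forall X : int -> int -> Cplx R,
    approaches A X (n \o s) <-> approaches B X (m \o s).

(* Main.v *)
Require Import Defs.
From HB Require Import structures.
From mathcomp Require Import all_boot all_order all_algebra.
From mathcomp Require Import all_classical all_reals all_analysis.
From mathcomp Require Import measurable_realfun complex.
From mathcomp Require Import ring lra zify.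

Set Implicit Arguments.
Unset Strict Implicit.
Unset Printing Implicit Defensive.

Import Order.TTheory GRing.Theory Num.Theory numFieldNormedType.Exports.

Local Open Scope classical_set_scope.
Local Open Scope ring_scope.

(** Write H_{ik} = <z p_k, p_i> and H'_{ik} = <z q_k, q_i>, with indices from 0.
    These matrices are bounded, and of Hessenberg shape: H_{ik} = 0 for
    i > k + 1, because z p_k has degree k + 1.  Both statements of the
    equivalence are compared with a third one, [entries_match]: for all integers
    i and j, the difference of H at (n_k + i, n_k + j) and H' at
    (m_k + i, m_k + j) tends to 0.

    Equality of right limits amounts to matching entries by compactness:
    a bounded matrix has a right limit along a refinement of any subsequence
    ([entries_match_same], [same_entries_match]).  When all indices are used, the
    same compactness shows that entries match exactly when 0 is the only right
    limit of the difference ([entries_match_unique]).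

    Matching entries give ratio asymptotics ([entries_to_ratios]).  The ratio
    p_m(z) / p_{m+1}(z) is H_{m+1,m} times the last diagonal entry of the
    resolvent at z of the truncation of H to indices at most m.  The truncations
    have norm at most the radius r of the support, so the Neumann series
    converges for |z| > r, uniformly in m ([neumann_bound]).  Its l-th term is a
    power of the truncation at its last corner, and by the Hessenberg shape it
    is a fixed polynomial in entries of H at bounded distance from that corner.
    Hence matching entries make each term, and then the ratios, asymptotically
    equal.

    Ratio asymptotics give matching entries when the subdiagonal stays away from
    0 ([ratios_to_entries]); the subdiagonal entries are the ratios
    kappa_m / kappa_{m+1}.  Dividing the expansion of z p_m by p_{m+1} yields
      z p_m / p_{m+1} = sum_d H_{m+1-d,m} p_{m+1-d} / p_{m+1},
    where the d-th quotient is a product of d consecutive ratios and has exact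
    order |z|^{-d} at infinity, the lower bound being where the subdiagonal
    matters.  Taking |z| large isolates the entries H_{m+1-d,m} one after the
    other, by induction on d.

    Both parts rest on the estimate |p_m(z)| (|z| - r) <= r |p_{m+1}(z)|
    for |z| > r ([christoffel_bound], [ratio_bound]), which also shows that the
    denominators do not vanish. *)

(** * Modulus and convergence of complex sequences *)

Section ComplexModulus.
Variable R : realType.
Implicit Types (x y z : Cplx R) (u v : nat -> Cplx R).

Lemma cabsE z : `|z| = ((cabs z)%:C)%C.
Proof. by []. Qed.

Lemma cabs_ge0 z : 0 <= cabs z.
Proof. by case: z => a b; exact: sqrtr_ge0. Qed.

Lemma cabs_lt z (e : R) : (cabs z < e) = (`|z| < (e%:C)%C :> Cplx R).
Proof. by rewrite cabsE; symmetry; exact: ltcR. Qed.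

Lemma cabs0 : cabs (0 : Cplx R) = 0. Proof. exact: ComplexField.Normc.normc0. Qed.
Lemma cabs1 : cabs (1 : Cplx R) = 1. Proof. exact: ComplexField.Normc.normc1. Qed.

Lemma cabs_eq0 z : (cabs z == 0) = (z == 0).
Proof.
apply/eqP/eqP => [|->]; last exact: cabs0.
exact: ComplexField.Normc.eq0_normc.
Qed.

Lemma cabs_gt0 z : (0 < cabs z) = (z != 0).
Proof. by rewrite lt_def cabs_eq0 cabs_ge0 andbT. Qed.

Lemma cabsM x y : cabs (x * y) = cabs x * cabs y.
Proof. exact: ComplexField.Normc.normcM. Qed.

Lemma cabsV x : cabs x^-1 = (cabs x)^-1.
Proof. exact: ComplexField.Normc.normcV. Qed.

Lemma cabsX x n : cabs (x ^+ n) = cabs x ^+ n.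
Proof. by elim: n => [|n IH]; rewrite ?cabs1 // !exprS cabsM IH. Qed.

Lemma cabsN x : cabs (- x) = cabs x.
Proof. exact: normcN. Qed.

Lemma cabsD x y : cabs (x + y) <= cabs x + cabs y.
Proof. exact: le_normcD. Qed.

Lemma cabsB x y : cabs (x - y) <= cabs x + cabs y.
Proof. by rewrite -(cabsN y); exact: cabsD. Qed.

Lemma cabsBC x y : cabs (x - y) = cabs (y - x).
Proof. by rewrite -cabsN opprB. Qed.

Lemma cabs_real (a : R) : 0 <= a -> cabs ((a%:C)%C : Cplx R) = a.
Proof. by move=> a0; rewrite /cabs /= expr0n /= addr0 sqrtr_sqr ger0_norm. Qed.

Lemma cabs_sum (I : Type) (r : seq I) (P : pred I) (F : I -> Cplx R) :
  cabs (\sum_(i <- r | P i) F i) <= \sum_(i <- r | P i) cabs (F i).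
Proof.
elim/big_ind2: _ => [|a b c d ha hb|//]; first by rewrite cabs0.
by apply: le_trans (cabsD _ _) _; exact: lerD.
Qed.

Lemma cabs_conj z : cabs (z^*)%R = cabs z.
Proof. by apply: complexI; rewrite -!cabsE norm_conjC. Qed.

Lemma conj_real (a : R) : (((a%:C)%C : Cplx R)^*)%R = (a%:C)%C.
Proof. by apply/eqP; rewrite eq_complex /= oppr0 !eqxx. Qed.

Lemma mul_conj z : z * (z^*)%R = ((cabs z ^+ 2)%:C)%C.
Proof. by rewrite -normCK cabsE -rmorphXn. Qed.

Lemma cabs_sqr z : cabs z ^+ 2 = complex.Re z ^+ 2 + complex.Im z ^+ 2.
Proof. by case: z => a b; rewrite /cabs /= sqr_sqrtr // addr_ge0 // sqr_ge0. Qed.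

Lemma Re_le_cabs z : `|complex.Re z| <= cabs z.
Proof.
rewrite -(@ler_pXn2r _ 2) ?nnegrE ?cabs_ge0 //.
by rewrite cabs_sqr real_normK ?num_real // lerDl sqr_ge0.
Qed.

Lemma Im_le_cabs z : `|complex.Im z| <= cabs z.
Proof.
rewrite -(@ler_pXn2r _ 2) ?nnegrE ?cabs_ge0 //.
by rewrite cabs_sqr real_normK ?num_real // lerDr sqr_ge0.
Qed.

Lemma cabs_le_ReIm z : cabs z <= `|complex.Re z| + `|complex.Im z|.
Proof.
rewrite -(@ler_pXn2r _ 2) ?nnegrE ?cabs_ge0 ?addr_ge0 //.
rewrite cabs_sqr sqrrD !real_normK ?num_real //.
by rewrite addrAC lerDl mulrn_wge0 // mulr_ge0.
Qed.

Lemma pos_CplxP (e : Cplx R) :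
  0 < e -> 0 < complex.Re e /\ e = ((complex.Re e)%:C)%C.
Proof. by case: e => a b; rewrite ltcE /= => /andP[/eqP -> ->]. Qed.

(** The topology of [Cplx R] is defined by radii in [Cplx R] itself; since a
    positive complex number is real, radii in [R] suffice, and all estimates
    can be carried out in the ordered field [R]. *)
Lemma cvgCP u (l : Cplx R) : (u @ \oo --> l) <->
  (forall e : R, 0 < e -> \forall k \near \oo, cabs (u k - l) < e).
Proof.
split=> [/cvgrPdist_lt h e e0|h].
  have /h : (0 : Cplx R) < (e%:C)%C by rewrite ltcR.
  by apply: filterS => k; rewrite cabsBC cabs_lt.
apply/cvgrPdist_lt => e /pos_CplxP[e0 ->].
by have := h _ e0; apply: filterS => k; rewrite cabsBC cabs_lt.
Qed.

Lemma cvgC0P u : (u @ \oo --> (0 : Cplx R)) <->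
  (forall e : R, 0 < e -> \forall k \near \oo, cabs (u k) < e).
Proof.
rewrite cvgCP; split=> h e /h; apply: filterS => k; by rewrite subr0.
Qed.

Lemma cvgC_near u v (l : Cplx R) : (\forall k \near \oo, u k = v k) ->
  u @ \oo --> l -> v @ \oo --> l.
Proof.
move=> uv /cvgCP h; apply/cvgCP => e /h; apply: filterS2 uv => k -> //.
Qed.

Lemma cvgC_add u v (l l' : Cplx R) : u @ \oo --> l -> v @ \oo --> l' ->
  (fun k => u k + v k) @ \oo --> l + l'.
Proof. by move=> hu hv; exact: (cvgD hu hv). Qed.

Lemma cvgC_sub u v (l l' : Cplx R) : u @ \oo --> l -> v @ \oo --> l' ->
  (fun k => u k - v k) @ \oo --> l - l'.
Proof. by move=> hu hv; exact: (cvgB hu hv). Qed.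

End ComplexModulus.

(** * A measure is carried by its support *)

Section SupportAndIntegral.
Variables (R : realType) (mu : {finite_measure set BorelC R -> \bar R}).
Local Notation S := (msupp mu).

Lemma open_disc (c : Cplx R) (e : R) : open [set w : Cplx R | cabs (w - c) < e].
Proof.
rewrite openE => w /= wc; rewrite /interior.
apply/nbhs_ballP; exists (((e - cabs (w - c))%:C)%C : Cplx R) => /=.
  by rewrite ltcR subr_gt0.
move=> v; rewrite -ball_normE /= -cabs_lt cabsBC => vw.
have -> : v - c = (v - w) + (w - c) by ring.
apply: le_lt_trans (cabsD _ _) _.
by rewrite -ltrBrDr (cabsBC v w) (cabsBC w c).
Qed.

Lemma nbhs_disc (U : set (Cplx R)) (z : Cplx R) : open U -> U z ->
  exists2 e : R, 0 < e & forall w, cabs (w - z) < e -> U w.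
Proof.
move=> oU Uz.
have /nbhs_ballP[e /= /pos_CplxP[e0 ->] eU] := open_nbhs_nbhs (conj oU Uz).
exists (complex.Re e) => // w wz; apply: eU.
by rewrite -ball_normE /= -cabs_lt cabsBC.
Qed.

Lemma measurable_openC (U : set (Cplx R)) :
  open U -> measurable (U : set (BorelC R)).
Proof. by move=> oU; exact: sub_sigma_algebra. Qed.

Lemma open_setC_msupp : open (~` S).
Proof.
rewrite openE => z /= /existsNP[U /not_implyP[oU /not_implyP[Uz mU]]].
rewrite /interior; apply: filterS (open_nbhs_nbhs (conj oU Uz)) => w Uw Sw.
by apply: mU; exact: Sw.
Qed.

Lemma measurable_msupp : measurable (S : set (BorelC R)).
Proof.
rewrite -[S]setCK; apply: measurableC.
exact: measurable_openC open_setC_msupp.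
Qed.

Lemma rat_approx (x e : R) : 0 < e -> exists q : rat, `|ratr q - x| < e.
Proof.
move=> e0; have /rat_in_itvoo[q] : x < x + e by rewrite ltrDl.
rewrite in_itv /= => /andP[xq qxe]; exists q.
by rewrite gtr0_norm ?subr_gt0 // ltrBlDl.
Qed.

(** A countable base of the topology of the complex plane. *)
Definition rat_disc (t : rat * rat * nat) : set (Cplx R) :=
  [set w : Cplx R | cabs (w - ((ratr t.1.1) +i* (ratr t.1.2))%C) < t.2.+1%:R^-1].

Lemma rat_disc_basis (U : set (Cplx R)) (z : Cplx R) : open U -> U z ->
  exists2 t, rat_disc t z & rat_disc t `<=` U.
Proof.
move=> oU Uz; have [e e0 eU] := nbhs_disc oU Uz.
have [n ne] : exists n : nat, n.+1%:R^-1 < e / 2.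
  have e20 : 0 < e / 2 by lra.
  have [n nP] := ltr_add_invr e20.
  by exists n; rewrite add0r in nP.
pose d : R := n.+1%:R^-1.
have d0 : 0 < d by rewrite invr_gt0.
have d20 : 0 < d / 2 by lra.
have [q1 h1] := rat_approx (complex.Re z) d20.
have [q2 h2] := rat_approx (complex.Im z) d20.
have zt : cabs (z - ((ratr q1) +i* (ratr q2))%C) < d.
  rewrite cabsBC; apply: le_lt_trans (cabs_le_ReIm _) _.
  by case: z h1 h2 {Uz eU} => a b /= h1 h2; lra.
exists (q1, q2, n); first by [].
move=> w; rewrite /rat_disc /= -/d => wt; apply: eU.
set c := (_ +i* _)%C in zt wt.
have -> : w - z = (w - c) - (z - c) by ring.
apply: le_lt_trans (cabsB _ _) _.
by move: ne zt wt; rewrite -/d; lra.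
Qed.

Lemma negligible_countable_union (T : countType) (F : T -> set (BorelC R)) :
  (forall t, mu.-negligible (F t)) -> mu.-negligible [set z | exists t, F t z].
Proof.
move=> nF.
have nG : mu.-negligible
    (\bigcup_k (if @unpickle T k is Some t then F t else set0)).
  by apply: negligible_bigcup => k; case: unpickle => // ; exact: negligible_set0.
apply: negligibleS nG => z [t Ft].
by exists (pickle t) => //; rewrite pickleK.
Qed.

(** Lindelof: a point outside the support has a null open neighbourhood, hence
    lies in a null rational disc, and there are only countably many of those. *)
Lemma measure_compl_msupp : mu (~` S) = 0%E.
Proof.
have mN : measurable (~` S : set (BorelC R)).
  exact: measurable_openC open_setC_msupp.
apply/(negligibleP _ mN).
pose F t : set (BorelC R) := if mu (rat_disc t) == 0%E then rat_disc t else set0.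
have nF : mu.-negligible [set z | exists t, F t z].
  apply: negligible_countable_union => t; rewrite /F.
  case: eqP => [h|_]; last exact: negligible_set0.
  by apply/negligibleP => //; apply: measurable_openC; exact: open_disc.
apply: negligibleS nF => z /existsNP[U /not_implyP[oU /not_implyP[Uz mU]]].
have [t tz tU] := rat_disc_basis oU Uz.
exists t; rewrite /F.
suff -> : mu (rat_disc t) == 0%E by [].
rewrite -measure_le0; apply: (@le_trans _ _ (mu U)).
  apply: le_measure; rewrite ?inE //; apply: measurable_openC => //.
  exact: open_disc.
by rewrite leNgt; apply/negP.
Qed.

(** The integrands that occur below.  The class is closed under the ring
    operations and conjugation, and because the complement of the support is
    null, boundedness on the support is enough for integrability. *)
Definition bmeas (f : Cplx R -> Cplx R) :=
  [/\ measurable_fun [set: BorelC R] (fun z => complex.Re (f z)),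
      measurable_fun [set: BorelC R] (fun z => complex.Im (f z)) &
      exists B : R, forall z, S z -> cabs (f z) <= B].

Lemma bmeas_cst (c : Cplx R) : bmeas (fun=> c).
Proof. by split; [exact: measurable_cst|exact: measurable_cst|exists (cabs c)]. Qed.

Lemma bmeas_conj f : bmeas f -> bmeas (fun z => (f z)^*)%R.
Proof.
move=> [m1 m2 [B hB]]; split.
- by apply: eq_measurable_fun m1 => z _; case: (f z).
- by apply: eq_measurable_fun (measurable_funN m2) => z _ /=; case: (f z).
- by exists B => z Sz; rewrite cabs_conj; exact: hB.
Qed.

Lemma bmeas_add f g : bmeas f -> bmeas g -> bmeas (fun z => f z + g z).
Proof.
move=> [m1 m2 [B hB]] [n1 n2 [D hD]]; split.
- apply: eq_measurable_fun (measurable_funD m1 n1) => z _ /=.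
  by case: (f z) (g z) => a b [c d].
- apply: eq_measurable_fun (measurable_funD m2 n2) => z _ /=.
  by case: (f z) (g z) => a b [c d].
- exists (B + D) => z Sz; apply: le_trans (cabsD _ _) _.
  by apply: lerD; [exact: hB|exact: hD].
Qed.

Lemma bmeas_mul f g : bmeas f -> bmeas g -> bmeas (fun z => f z * g z).
Proof.
move=> [m1 m2 [B hB]] [n1 n2 [D hD]]; split.
- have m := measurable_funB (measurable_funM m1 n1) (measurable_funM m2 n2).
  apply: eq_measurable_fun m => z _ /=.
  by case: (f z) (g z) => a b [c d].
- have m := measurable_funD (measurable_funM m1 n2) (measurable_funM m2 n1).
  apply: eq_measurable_fun m => z _ /=.
  by case: (f z) (g z) => a b [c d].
- exists (B * D) => z Sz; rewrite cabsM.
  by apply: ler_pM; rewrite ?cabs_ge0 //; [exact: hB|exact: hD].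
Qed.

Lemma contraction_continuous (f : Cplx R -> R) :
  (forall v w, `|f v - f w| <= cabs (v - w)) -> continuous f.
Proof.
move=> hf z; apply/(@cvgrPdist_lt _ _ _ (nbhs z) (nbhs_filter z)) => e e0.
apply/nbhs_ballP; exists ((e%:C)%C : Cplx R) => /=; first by rewrite ltcR.
by move=> w; rewrite -ball_normE /= -cabs_lt; exact: le_lt_trans.
Qed.

Lemma continuous_measurableC (f : Cplx R -> R) :
  continuous f -> measurable_fun [set: BorelC R] f.
Proof.
move=> /continuousP cf; apply: (measurability _ (RGenOpens.measurableE R)).
move=> _ [_ [a [b ->] <-]]; rewrite setTI; apply: measurable_openC.
by apply: cf; exact: interval_open.
Qed.

Lemma measurable_Re : measurable_fun [set: BorelC R] (@complex.Re R).
Proof.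
apply: continuous_measurableC; apply: contraction_continuous => v w.
by apply: le_trans (Re_le_cabs _); case: v w => ? ? [].
Qed.

Lemma measurable_Im : measurable_fun [set: BorelC R] (@complex.Im R).
Proof.
apply: continuous_measurableC; apply: contraction_continuous => v w.
by apply: le_trans (Im_le_cabs _); case: v w => ? ? [].
Qed.

Variable r : R.
Hypothesis Sr : forall z, S z -> cabs z <= r.

Lemma bmeas_id : bmeas id.
Proof. by split; [exact: measurable_Re|exact: measurable_Im|exists r]. Qed.

Lemma bmeas_horner (g : {poly Cplx R}) : bmeas (fun z => g.[z]).
Proof.
elim/poly_ind: g => [|g c IH].
  by under eq_fun do rewrite horner0; exact: bmeas_cst.
under eq_fun do rewrite hornerMXaddC.
by apply: bmeas_add (bmeas_cst c); apply: bmeas_mul IH bmeas_id.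
Qed.

Lemma bounded_integrable (f : BorelC R -> R) : measurable_fun [set: BorelC R] f ->
  (exists B : R, forall z, S z -> `|f z| <= B) -> mu.-integrable setT (EFin \o f).
Proof.
move=> mf [B hB]; have mS := measurable_msupp; have mC := measurableC mS.
apply/(@negligible_integrable _ _ _ mu setT (~` S)) => //.
- exact/measurable_EFinP.
- exact: measure_compl_msupp.
rewrite setTD setCK; apply: measurable_bounded_integrable => //.
- by rewrite -ge0_fin_numE //; exact: fin_num_measure.
- exact: measurable_funS mf.
exists B; split; first exact: num_real.
by move=> x Bx z Sz; apply: le_trans (hB z Sz) _; exact: ltW.
Qed.

Lemma Rintegral_msupp (f : BorelC R -> R) : mu.-integrable setT (EFin \o f) ->
  \int[mu]_z f z = \int[mu]_(z in S) f z.
Proof.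
move=> fi; have mS := measurable_msupp.
rewrite /Rintegral.
rewrite (@negligible_integral _ (BorelC R) R mu setT (~` S)) ?setTD ?setCK //.
- exact: measurableC.
- exact: measure_compl_msupp.
Qed.

Lemma bmeas_integrable_Re f : bmeas f ->
  mu.-integrable setT (EFin \o (fun z => complex.Re (f z))).
Proof.
move=> [m1 _ [B hB]]; apply: bounded_integrable => //; exists B => z Sz.
exact: le_trans (Re_le_cabs _) (hB z Sz).
Qed.

Lemma bmeas_integrable_Im f : bmeas f ->
  mu.-integrable setT (EFin \o (fun z => complex.Im (f z))).
Proof.
move=> [_ m1 [B hB]]; apply: bounded_integrable => //; exists B => z Sz.
exact: le_trans (Im_le_cabs _) (hB z Sz).
Qed.

Lemma cintegralD f g : bmeas f -> bmeas g ->
  cintegral mu (fun z => f z + g z) = cintegral mu f + cintegral mu g.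
Proof.
move=> nf ng; apply/eqP; rewrite eq_complex /=; apply/andP; split; apply/eqP.
  rewrite -RintegralD //; try exact: bmeas_integrable_Re.
  by apply: eq_Rintegral => z _; case: (f z) (g z) => ? ? [].
rewrite -RintegralD //; try exact: bmeas_integrable_Im.
by apply: eq_Rintegral => z _; case: (f z) (g z) => ? ? [].
Qed.

Lemma cintegralZ (c : Cplx R) f : bmeas f ->
  cintegral mu (fun z => c * f z) = c * cintegral mu f.
Proof.
move=> nf; have iR := bmeas_integrable_Re nf; have iI := bmeas_integrable_Im nf.
case: c => a b; apply/eqP; rewrite eq_complex /=; apply/andP; split; apply/eqP.
  rewrite -!RintegralZl // -RintegralB //; last 2 first.
  - by have := integrableZl measurableT a iR.
  - by have := integrableZl measurableT b iI.
  by apply: eq_Rintegral => z _; case: (f z).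
rewrite -!RintegralZl // -RintegralD //; last 2 first.
- by have := integrableZl measurableT a iI.
- by have := integrableZl measurableT b iR.
by apply: eq_Rintegral => z _; case: (f z).
Qed.

Lemma cintegral_conj f : bmeas f ->
  cintegral mu (fun z => (f z)^*)%R = ((cintegral mu f)^*)%R.
Proof.
move=> nf; have iI := bmeas_integrable_Im nf.
apply/eqP; rewrite eq_complex /=; apply/andP; split; apply/eqP.
  by apply: eq_Rintegral => z _; case: (f z).
rewrite -[RHS]mulN1r -RintegralZl //.
by apply: eq_Rintegral => z _; case: (f z) => ? ? /=; rewrite mulN1r.
Qed.

Definition ip (g h : {poly Cplx R}) : Cplx R :=
  cintegral mu (fun z => g.[z] * (h.[z])^*).

Definition nrm2 (g : {poly Cplx R}) : R := \int[mu]_z (cabs g.[z] ^+ 2).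

Lemma bmeas_ip g h : bmeas (fun z => g.[z] * (h.[z])^*).
Proof. by apply: bmeas_mul; [|apply: bmeas_conj]; exact: bmeas_horner. Qed.

Lemma ipDl g h k : ip (g + h) k = ip g k + ip h k.
Proof.
rewrite /ip -cintegralD; try exact: bmeas_ip.
by congr cintegral; apply/funext => z; rewrite hornerD mulrDl.
Qed.

Lemma ipZl c g k : ip (c *: g) k = c * ip g k.
Proof.
rewrite /ip -cintegralZ; last exact: bmeas_ip.
by congr cintegral; apply/funext => z; rewrite hornerZ mulrA.
Qed.

Lemma ip_conj g h : ip h g = ((ip g h)^*)%R.
Proof.
rewrite /ip -cintegral_conj; last exact: bmeas_ip.
by congr cintegral; apply/funext => z; rewrite rmorphM /= conjCK mulrC.
Qed.

Lemma ip_nrm2 g : ip g g = ((nrm2 g)%:C)%C.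
Proof.
apply/eqP; rewrite eq_complex /=; apply/andP; split; apply/eqP.
  by apply: eq_Rintegral => z _; rewrite mul_conj.
rewrite -[RHS](mul0r (fine (mu setT))) -Rintegral_cst //.
by apply: eq_Rintegral => z _; rewrite mul_conj.
Qed.

Lemma nrm2_ge0 g : 0 <= nrm2 g.
Proof. by apply: Rintegral_ge0 => z _; rewrite sqr_ge0. Qed.

(** The integrals may be restricted to the support, and there the modulus of
    the variable is at most [r].  All later estimates come from this one. *)
Lemma nrm2_mulX g : nrm2 ('X * g) <= r ^+ 2 * nrm2 g.
Proof.
have iG (k : {poly Cplx R}) :
    mu.-integrable setT (EFin \o (fun z : BorelC R => cabs k.[z] ^+ 2)).
  have := bmeas_integrable_Re (bmeas_ip k k); apply: eq_integrable => // z _ /=.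
  by rewrite mul_conj.
have iG2 := integrableZl measurableT (r ^+ 2) (iG g).
rewrite /nrm2 -RintegralZl // !Rintegral_msupp //; apply: le_Rintegral.
- exact: measurable_msupp.
- by apply: integrableS (iG _) => //; exact: measurable_msupp.
- by apply: integrableS iG2 => //; exact: measurable_msupp.
move=> z Sz; rewrite mulrC hornerMX cabsM exprMn mulrC ler_wpM2r ?sqr_ge0 //.
by rewrite ler_pXn2r ?nnegrE ?cabs_ge0 ?Sr //; exact: le_trans (cabs_ge0 z) (Sr Sz).
Qed.

End SupportAndIntegral.

(** * Orthonormal expansions and the Hessenberg matrix *)

Section OrthonormalPolynomials.
Variables (R : realType) (mu : {finite_measure set BorelC R -> \bar R}).
Variable p : nat -> {poly Cplx R}.
Hypothesis p_on : orthonormal_polys mu p.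
Variable r : R.
Hypothesis r0 : 0 < r.
Hypothesis Sr : forall z, msupp mu z -> cabs z <= r.
Local Notation ip := (ip mu).
Local Notation nrm2 := (nrm2 mu).

Lemma ip_suml I (s : seq I) (P : pred I) (F : I -> {poly Cplx R}) h :
  ip (\sum_(i <- s | P i) F i) h = \sum_(i <- s | P i) ip (F i) h.
Proof.
have ip0 : ip 0 h = 0 by rewrite -(scale0r 0) (ipZl Sr) mul0r.
by elim/big_rec2: _ => // i x y _ <-; rewrite (ipDl Sr).
Qed.

Lemma ipDr g h k : ip g (h + k) = ip g h + ip g k.
Proof. by rewrite !(ip_conj Sr _ g) (ipDl Sr) rmorphD. Qed.

Lemma ipZr c g h : ip g (c *: h) = (c^*)%R * ip g h.
Proof. by rewrite !(ip_conj Sr _ g) (ipZl Sr) rmorphM. Qed.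

Lemma ip_sumr I (s : seq I) (P : pred I) (F : I -> {poly Cplx R}) h :
  ip h (\sum_(i <- s | P i) F i) = \sum_(i <- s | P i) ip h (F i).
Proof.
rewrite (ip_conj Sr _ h) ip_suml rmorph_sum.
by apply: eq_bigr => i _; rewrite [RHS](ip_conj Sr).
Qed.

Lemma ip_orthonormal n m : ip (p n) (p m) = (m == n)%:R.
Proof. by case: p_on => _; exact. Qed.

Lemma size_p n : size (p n) = n.+1.
Proof. by case: p_on => /(_ n)[]. Qed.

Lemma lead_p_gt0 n : 0 < lead_coef (p n).
Proof. by case: p_on => /(_ n)[]. Qed.

Lemma coef_p n : (p n)`_n = lead_coef (p n).
Proof. by rewrite lead_coefE size_p. Qed.

Definition lincomb n (x : nat -> Cplx R) : {poly Cplx R} := \sum_(i < n) x i *: p i.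

Lemma ip_lincomb n x j : ip (lincomb n x) (p j) = if (j < n)%N then x j else 0.
Proof.
rewrite ip_suml.
under eq_bigr do rewrite (ipZl Sr) ip_orthonormal.
case: ltnP => jn.
  rewrite (bigD1 (Ordinal jn)) //= eqxx mulr1 big1 ?addr0 // => i.
  by rewrite -val_eqE /= eq_sym => /negbTE ->; rewrite mulr0.
by rewrite big1 // => i _; rewrite gtn_eqF ?mulr0 // (leq_trans (ltn_ord i)).
Qed.

Lemma nrm2_lincomb n x : nrm2 (lincomb n x) = \sum_(i < n) cabs (x i) ^+ 2.
Proof.
apply: (@complexI R); rewrite -(ip_nrm2 mu) {2}/lincomb ip_sumr rmorph_sum /=.
apply: eq_bigr => i _; rewrite ipZr ip_lincomb ltn_ord mulrC mul_conj //.
Qed.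

(** Since [p n] has degree exactly [n], a multiple of it removes the term of
    degree [n]; orthonormality then identifies the coordinates. *)
Lemma lincomb_expand n (g : {poly Cplx R}) :
  (size g <= n)%N -> g = lincomb n (fun i => ip g (p i)).
Proof.
suff: forall n (g : {poly Cplx R}), (size g <= n)%N -> exists x, g = lincomb n x.
  move=> h sg; have [x gx] := h _ _ sg; rewrite {1}gx; apply: eq_bigr => i _.
  by rewrite gx ip_lincomb ltn_ord.
elim=> [|{}n IH] {}g.
  rewrite leqn0 size_poly_eq0 => /eqP ->; exists (fun=> 0).
  by rewrite /lincomb big_ord0.
move=> sg; set c := g`_n / lead_coef (p n).
have [] := IH (g - c *: p n).
  apply/leq_sizeP => j; rewrite leq_eqVlt => /orP[/eqP <-|nj].
    by rewrite coefB coefZ coef_p divfK ?subrr // gt_eqF ?lead_p_gt0.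
  rewrite coefB coefZ (nth_default 0 (s := p n)) ?size_p // mulr0 subr0.
  by rewrite nth_default // (leq_trans sg).
move=> x gx; exists (fun i => if i == n then c else x i).
rewrite /lincomb big_ord_recr /= eqxx -[LHS](subrK (c *: p n)) gx; congr (_ + _).
by apply: eq_bigr => i _; rewrite ltn_eqF.
Qed.

(** The Bergman shift matrix with rows and columns numbered from 0, so that
    indices are those of the polynomials. *)
Definition hess i k : Cplx R := bergman_shift mu p i.+1 k.+1.
Local Notation H := hess.

Lemma hessE i k : H i k = ip ('X * p k) (p i).
Proof.
congr cintegral; apply/funext => z /=.
by rewrite (mulrC 'X) hornerMX [in LHS](mulrC z).
Qed.

Lemma size_mulX_p k : size ('X * p k) = k.+2.
Proof. by rewrite mulrC size_mulX ?size_p // -size_poly_gt0 size_p. Qed.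

Lemma mulX_p k : 'X * p k = lincomb k.+2 (H^~ k).
Proof.
rewrite {1}(@lincomb_expand k.+2 ('X * p k)) ?size_mulX_p //.
by apply: eq_bigr => i _; rewrite hessE.
Qed.

Lemma hess_eq0 i k : (k.+1 < i)%N -> H i k = 0.
Proof. by move=> ki; rewrite hessE mulX_p ip_lincomb ltnNge ki. Qed.

(** The entries of column [k] are the coordinates of z p_k, a polynomial of
    norm at most [r]. *)
Lemma hess_le i k : cabs (H i k) <= r.
Proof.
case: (ltnP k.+1 i) => [/hess_eq0 ->|ik]; first by rewrite cabs0 ltW.
rewrite -(@ler_pXn2r _ 2) ?nnegrE ?cabs_ge0 ?(ltW r0) //.
have n1 : nrm2 (p k) = 1.
  by apply: (@complexI R); rewrite -(ip_nrm2 mu) ip_orthonormal eqxx.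
have := nrm2_mulX Sr (p k); rewrite n1 mulr1 mulX_p nrm2_lincomb; apply: le_trans.
have ik2 : (i < k.+2)%N by [].
by rewrite (bigD1 (Ordinal ik2)) //= lerDl sumr_ge0 // => j _; exact: sqr_ge0.
Qed.

(** Compare the leading coefficients in the expansion of z p_k. *)
Lemma hess_subdiag k : H k.+1 k = lead_coef (p k) / lead_coef (p k.+1).
Proof.
have l0 := lt0r_neq0 (lead_p_gt0 k.+1).
apply: (mulIf l0); rewrite divfK //.
have := congr1 (fun g : {poly Cplx R} => g`_k.+1) (mulX_p k).
rewrite coefXM /= coef_p => ->; rewrite /lincomb coef_sum big_ord_recr /=.
rewrite big1 ?add0r => [|i _]; first by rewrite coefZ coef_p.
by rewrite coefZ nth_default ?mulr0 // size_p ltnS -ltnS.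
Qed.

Lemma cabs_hess_subdiag k : cabs (H k.+1 k) = kappa p k / kappa p k.+1.
Proof.
have [a0 aE] := pos_CplxP (lead_p_gt0 k).
have [b0 bE] := pos_CplxP (lead_p_gt0 k.+1).
rewrite hess_subdiag cabsM cabsV /kappa.
by rewrite [in LHS]aE [in X in _ / X = _]bE !cabs_real ?ltW.
Qed.

(** This is Cauchy-Schwarz combined with the bound on multiplication by z.  With
    c the phase of <zg, g>, both come out of the single inequality
    0 <= ||zg - r c g||^2 = ||zg||^2 - 2 r |<zg, g>| + r^2 ||g||^2. *)
Lemma numerical_range g : cabs (ip ('X * g) g) <= r * nrm2 g.
Proof.
move wE : (ip ('X * g) g) => w; have [->|w0] := eqVneq w 0.
  by rewrite cabs0 mulr_ge0 ?nrm2_ge0 // ltW.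
have cw : 0 < cabs w by rewrite cabs_gt0.
have cw0 : (((cabs w)%:C)%C : Cplx R) != 0 by rewrite -cabsE normr_eq0.
pose c : Cplx R := w / ((cabs w)%:C)%C.
pose h := 'X * g - (((r%:C)%C : Cplx R) * c) *: g.
have hh : ip h h = ip ('X * g) ('X * g) - (((2 * r * cabs w)%:C)%C : Cplx R)
    + (((r ^+ 2 * nrm2 g)%:C)%C : Cplx R).
  rewrite /h -scaleNr (ipDl Sr) !ipDr !ipZr !(ipZl Sr) (ip_conj Sr ('X * g) g) wE.
  rewrite (ip_nrm2 mu g).
  have wc : (c^*)%R * w = ((cabs w)%:C)%C.
    rewrite /c rmorphM fmorphV /= conj_real mulrAC (mulrC (w^*)%R) mul_conj.
    by rewrite rmorphXn /= expr2 mulfK.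
  have wc2 : c * (w^*)%R = ((cabs w)%:C)%C.
    by rewrite -[LHS]conjCK rmorphM /= conjCK wc conj_real.
  have cc : c * (c^*)%R = 1.
    rewrite mul_conj /c cabsM cabsV cabs_real ?cabs_ge0 // divff ?expr1n //.
    by rewrite gt_eqF.
  rewrite rmorphN rmorphM /= conj_real.
  transitivity (ip ('X * g) ('X * g)
     - ((r%:C)%C : Cplx R) * ((c^*)%R * w + c * (w^*)%R)
     + ((r%:C)%C : Cplx R) ^+ 2 * (c * (c^*)%R) * ((nrm2 g)%:C)%C).
    by ring.
  rewrite wc wc2 cc mulr1.
  have -> : ((2 * r * cabs w)%:C)%C =
      ((r%:C)%C : Cplx R) * (((cabs w)%:C)%C + ((cabs w)%:C)%C).
    by rewrite -rmorphD -rmorphM /=; congr (_%:C)%C; ring.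
  by rewrite [((r ^+ 2 * _)%:C)%C]rmorphM rmorphXn.
have := congr1 (@complex.Re R) hh; rewrite !(ip_nrm2 mu) /= => e.
have := nrm2_ge0 mu h; rewrite e; have := nrm2_mulX Sr g.
move=> h1 h2; have : 2 * r * cabs w <= 2 * r * (r * nrm2 g) by nra.
by rewrite ler_pM2l // mulr_gt0.
Qed.

Lemma recurrence z k : z * (p k).[z] = \sum_(i < k.+2) H i k * (p i).[z].
Proof.
have := congr1 (fun g : {poly Cplx R} => g.[z]) (mulX_p k).
rewrite mulrC hornerMX mulrC => ->; rewrite /lincomb horner_sum.
by apply: eq_bigr => i _; rewrite hornerZ.
Qed.

(** The left side is (|z| - r) ||g||^2 for the reproducing kernel
    g = sum_{i <= n} conj(p_i(z)) p_i.  By the recurrence, the vector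
    (p_0(z), ..., p_n(z)) fails to be a left eigenvector of the truncated matrix
    only in its last column, which gives
    <wg, g> = z ||g||^2 - H_{n+1,n} p_{n+1}(z) conj(p_n(z)),
    where w is the variable of g; and |<wg, g>| <= r ||g||^2. *)
Lemma christoffel_bound z n :
  (cabs z - r) * (\sum_(i < n.+1) cabs (p i).[z] ^+ 2)
    <= r * (cabs (p n.+1).[z] * cabs (p n).[z]).
Proof.
pose v i := (p i).[z].
pose g := lincomb n.+1 (fun i => (v i)^*)%R.
have ng : nrm2 g = \sum_(i < n.+1) cabs (v i) ^+ 2.
  by rewrite nrm2_lincomb; apply: eq_bigr => i _; rewrite cabs_conj.
have trunc (k : 'I_n.+1) : \sum_(i < n.+1) v i * H i k =
    z * v k - (if k == ord_max then H n.+1 n * v n.+1 else 0).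
  rewrite recurrence.
  have -> : \sum_(i < k.+2) H i k * v i = \sum_(i < n.+2) H i k * v i.
    have kn : (k.+2 <= n.+2)%N by rewrite !ltnS -ltnS.
    rewrite (big_ord_widen n.+2 (fun i => H i k * v i) kn).
    rewrite [RHS](bigID (fun i : 'I_n.+2 => (i < k.+2)%N)) /=.
    rewrite [X in _ + X]big1 ?addr0 //.
    by move=> i; rewrite -leqNgt => /hess_eq0 ->; rewrite mul0r.
  rewrite [X in _ = X - _]big_ord_recr /=; case: eqP => [->|/eqP kn].
    by rewrite addrK; apply: eq_bigr => i _; rewrite mulrC.
  rewrite subr0 hess_eq0 ?mul0r ?addr0; last first.
    by rewrite ltnS ltn_neqAle -ltnS ltn_ord andbT.
  by apply: eq_bigr => i _; rewrite mulrC.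
have E : ip ('X * g) g = z * ((nrm2 g)%:C)%C - H n.+1 n * v n.+1 * (v n)^*%R.
  rewrite {1}/g /lincomb mulr_sumr ip_suml.
  transitivity (\sum_(k < n.+1) (v k)^*%R * (\sum_(i < n.+1) v i * H i k)).
    apply: eq_bigr => k _; rewrite -scalerAr (ipZl Sr); congr (_ * _).
    rewrite /g /lincomb ip_sumr; apply: eq_bigr => i _.
    by rewrite ipZr conjCK -hessE.
  under eq_bigr do rewrite trunc mulrBr.
  rewrite sumrB; congr (_ - _).
    rewrite ng rmorph_sum mulr_sumr; apply: eq_bigr => i _ /=.
    by rewrite -mul_conj; ring.
  rewrite (bigD1 ord_max) //= eqxx big1 ?addr0 => [|i /negbTE ->].
    by rewrite mulrC.
  by rewrite mulr0.
have N := numerical_range g.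
have : cabs (z * ((nrm2 g)%:C)%C) <=
    r * nrm2 g + cabs (H n.+1 n * v n.+1 * (v n)^*%R).
  have -> : z * ((nrm2 g)%:C)%C =
      ip ('X * g) g + H n.+1 n * v n.+1 * (v n)^*%R.
    by rewrite E subrK.
  by apply: le_trans (cabsD _ _) _; rewrite lerD2r.
rewrite !cabsM cabs_conj cabs_real ?nrm2_ge0 // -/(v n.+1) -/(v n) -ng => h.
have h2 : cabs (H n.+1 n) * cabs (v n.+1) * cabs (v n) <=
    r * (cabs (v n.+1) * cabs (v n)).
  by rewrite -mulrA ler_wpM2r ?mulr_ge0 ?cabs_ge0 // hess_le.
by rewrite mulrBl; lra.
Qed.

Section OutsideDisc.
Variable z : Cplx R.
Hypothesis rz : r < cabs z.
Let b := r / (cabs z - r).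

Lemma ratio_bound n : cabs (p n).[z] <= b * cabs (p n.+1).[z].
Proof.
have [->|pn] := eqVneq (cabs (p n).[z]) 0.
  by rewrite mulr_ge0 ?cabs_ge0 // divr_ge0 ?subr_ge0 // ltW.
have pn0 : 0 < cabs (p n).[z] by rewrite lt_def pn cabs_ge0.
rewrite /b mulrAC ler_pdivlMr ?subr_gt0 //.
have h : (cabs z - r) * cabs (p n).[z] ^+ 2 <=
    r * (cabs (p n.+1).[z] * cabs (p n).[z]).
  apply: le_trans (christoffel_bound z n).
  rewrite ler_wpM2l ?subr_ge0 ?(ltW rz) //.
  by rewrite big_ord_recr /= lerDr sumr_ge0 // => i _; exact: sqr_ge0.
rewrite -(ler_pM2r pn0); lra.
Qed.

(** The zeros lie in the disc of radius [r]: a zero of p_{n+1} outside would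
    by the preceding bound be a zero of p_n, and so on down to the constant p_0. *)
Lemma p_neq0 n : (p n).[z] != 0.
Proof.
elim: n => [|n IH].
  rewrite (size1_polyC (eq_leq (size_p 0))) hornerC coef_p.
  by rewrite gt_eqF ?lead_p_gt0.
apply/eqP => h; have := ratio_bound n; rewrite h cabs0 mulr0.
by rewrite leNgt cabs_gt0 IH.
Qed.

Lemma square_sum_bound n :
  \sum_(i < n.+1) cabs (p i).[z] ^+ 2 <= b ^+ 2 * cabs (p n.+1).[z] ^+ 2.
Proof.
have d0 : 0 < cabs z - r by rewrite subr_gt0.
rewrite -(ler_pM2l d0); apply: le_trans (christoffel_bound z n) _.
have := ratio_bound n; have := cabs_ge0 (p n.+1).[z].
set x := cabs _; set y := cabs _ => x0 yx.
have -> : (cabs z - r) * (b ^+ 2 * x ^+ 2) = r * (x * (b * x)).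
  rewrite /b; field; exact: lt0r_neq0.
by rewrite !ler_wpM2l // ltW.
Qed.

End OutsideDisc.
End OrthonormalPolynomials.

(** * Truncations of the shift and the Neumann series *)

Section TruncatedShift.
Variables (R : realType) (mu : {finite_measure set BorelC R -> \bar R}).
Variable p : nat -> {poly Cplx R}.
Hypothesis p_on : orthonormal_polys mu p.
Variable r : R.
Hypothesis r0 : 0 < r.
Hypothesis Sr : forall z, msupp mu z -> cabs z <= r.
Local Notation H := (hess mu p).

(** On indices up to [m] this is the action of the truncated matrix
    (H_{ik})_{i,k <= m}; the value at [m.+1] is the component that the
    truncation discards. *)
Definition trunc_apply m (x : nat -> Cplx R) : nat -> Cplx R :=
  fun i => \sum_(k < m.+1) H i k * x k.

(** On indices up to [m], the last column of the [l]-th power of the truncated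
    matrix. *)
Definition trunc_pow m l : nat -> Cplx R :=
  iter l (trunc_apply m) (fun i => (i == m)%:R).

Lemma mulX_lincomb m x : 'X * lincomb p m.+1 x = lincomb p m.+2 (trunc_apply m x).
Proof.
rewrite /lincomb mulr_sumr.
transitivity (\sum_(k < m.+1) \sum_(i < m.+2) (H i k * x k) *: p i).
  apply: eq_bigr => k _; rewrite -scalerAr (mulX_p p_on Sr) scaler_sumr.
  have km : (k.+2 <= m.+2)%N by rewrite !ltnS -ltnS.
  rewrite (big_ord_widen m.+2 (fun i => x k *: (H i k *: p i)) km).
  rewrite [RHS](bigID (fun i : 'I_m.+2 => (i < k.+2)%N)) /= [X in _ + X]big1 ?addr0.
    by apply: eq_bigr => i _; rewrite scalerA mulrC.
  by move=> i; rewrite -leqNgt => /(hess_eq0 p_on Sr) ->; rewrite mul0r scale0r.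
rewrite exchange_big; apply: eq_bigr => i _ /=.
by rewrite /trunc_apply scaler_suml.
Qed.

(** Multiplication by z followed by the loss of one coordinate. *)
Lemma trunc_apply_norm m x :
  \sum_(i < m.+1) cabs (trunc_apply m x i) ^+ 2
    <= r ^+ 2 * \sum_(i < m.+1) cabs (x i) ^+ 2.
Proof.
rewrite -!(nrm2_lincomb p_on Sr); apply: le_trans (nrm2_mulX Sr _).
rewrite mulX_lincomb !(nrm2_lincomb p_on Sr) [leRHS]big_ord_recr /=.
by rewrite lerDl sqr_ge0.
Qed.

Lemma trunc_pow_norm m l :
  \sum_(i < m.+1) cabs (trunc_pow m l i) ^+ 2 <= (r ^+ l) ^+ 2.
Proof.
elim: l => [|l IH].
  rewrite big_ord_recr /= eqxx cabs1 big1 ?add0r ?expr0 // => i _.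
  by rewrite ltn_eqF // cabs0 expr0n.
apply: le_trans (trunc_apply_norm _ _) _.
by rewrite (exprS r l) exprMn ler_wpM2l // sqr_ge0.
Qed.

(** The Hessenberg shape makes the last columns of the powers local: an entry at
    distance [e] from the corner only depends on entries at distance at most
    [e.+1], however large [m] is. *)
Lemma trunc_apply_local m x e : (e < m)%N ->
  trunc_apply m x (m - e) = \sum_(d < e.+2) H (m - e) (m - d) * x (m - d)%N.
Proof.
move=> em; rewrite /trunc_apply (reindex_inj rev_ord_inj) /=.
have em2 : (e.+2 <= m.+1)%N by [].
rewrite (big_ord_widen m.+1 (fun d => H (m - e) (m - d) * x (m - d)%N) em2).
rewrite [LHS](bigID (fun d : 'I_m.+1 => (d < e.+2)%N)) /= [X in _ + X]big1 ?addr0.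
  by apply: eq_bigr => d _; rewrite subSS.
move=> d; rewrite -leqNgt => ed; rewrite subSS (hess_eq0 p_on Sr) ?mul0r //.
by move: (ltn_ord d) ed; clear; lia.
Qed.

Lemma trunc_apply_dual z m x :
  \sum_(i < m.+1) trunc_apply m x i * (p i).[z] =
  z * (\sum_(i < m.+1) x i * (p i).[z]) - H m.+1 m * x m * (p m.+1).[z].
Proof.
have := congr1 (fun g : {poly Cplx R} => g.[z]) (mulX_lincomb m x).
have hc n y : (lincomb p n y).[z] = \sum_(i < n) y i * (p i).[z].
  by rewrite /lincomb horner_sum; apply: eq_bigr => i _; rewrite hornerZ.
rewrite mulrC hornerMX !hc mulrC => ->; rewrite [X in _ = X - _]big_ord_recr /=.
suff -> : trunc_apply m x m.+1 = H m.+1 m * x m by rewrite addrK.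
rewrite /trunc_apply big_ord_recr /= big1 ?add0r // => i _.
by rewrite (hess_eq0 p_on Sr) ?mul0r // ltnS.
Qed.

Variable z : Cplx R.
Hypothesis rz : r < cabs z.
Let b := r / (cabs z - r).

Lemma z_neq0 : z != 0.
Proof. by rewrite -cabs_gt0 (lt_trans r0). Qed.

Definition ratio m : Cplx R := (p m).[z] / (p m.+1).[z].

(** [ratio m] is H_{m+1,m} times the corner entry of the resolvent at z of the
    truncated matrix; this is its Neumann series with remainder.  It follows by
    iterating [trunc_apply_dual], without inverting a matrix. *)
Lemma neumann_identity m L :
  ratio m = \sum_(l < L) z^-1 ^+ l.+1 * (H m.+1 m * trunc_pow m l m)
    + z^-1 ^+ L * \sum_(i < m.+1) trunc_pow m L i * ((p i).[z] / (p m.+1).[z]).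
Proof.
have pm := p_neq0 p_on r0 Sr rz m.+1.
elim: L => [|L IH].
  rewrite big_ord0 add0r expr0 mul1r big_ord_recr /= eqxx mul1r.
  rewrite big1 ?add0r // => i _.
  by rewrite ltn_eqF // mul0r.
rewrite IH [X in _ = X + _]big_ord_recr /= -addrA; congr (_ + _).
have fact x : \sum_(i < m.+1) x i * ((p i).[z] / (p m.+1).[z])
   = (\sum_(i < m.+1) x i * (p i).[z]) / (p m.+1).[z].
  by rewrite mulr_suml; apply: eq_bigr => i _; rewrite mulrA.
rewrite (fact (fun i => trunc_pow m L i)).
rewrite (fact (fun i => trunc_apply m (trunc_pow m L) i)).
rewrite trunc_apply_dual.
have z0 := z_neq0; rewrite exprS; field; rewrite ?z0 ?pm ?andbT ?expf_neq0 //.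
Qed.

(** The remainder pairs a vector of norm at most r^L with one of norm at most
    [b]; the product is bounded by the sum of squares after scaling by r^L. *)
Lemma neumann_bound m L :
  cabs (ratio m - \sum_(l < L) z^-1 ^+ l.+1 * (H m.+1 m * trunc_pow m l m))
    <= (r / cabs z) ^+ L * (1 + b ^+ 2).
Proof.
have pm := p_neq0 p_on r0 Sr rz m.+1.
have pm0 : 0 < cabs (p m.+1).[z] by rewrite cabs_gt0.
rewrite {1}(neumann_identity m L) addrC addKr cabsM cabsX cabsV.
rewrite exprMn (mulrC (r ^+ L)) -mulrA.
rewrite ler_wpM2l ?exprn_ge0 ?invr_ge0 ?cabs_ge0 //.
apply: le_trans (cabs_sum _ _ _) _.
have rL : 0 < r ^+ L by rewrite exprn_gt0.
pose X := \sum_(i < m.+1) cabs (trunc_pow m L i) ^+ 2.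
pose Y := \sum_(i < m.+1) cabs ((p i).[z] / (p m.+1).[z]) ^+ 2.
have hX : X / (r ^+ L) ^+ 2 <= 1.
  by rewrite ler_pdivrMr ?exprn_gt0 // mul1r trunc_pow_norm.
have hY : Y <= b ^+ 2.
  rewrite /Y; under eq_bigr do rewrite cabsM cabsV exprMn exprVn.
  rewrite -mulr_suml ler_pdivrMr ?exprn_gt0 //.
  exact: (square_sum_bound p_on r0 Sr rz m).
suff : \sum_(i < m.+1) cabs (trunc_pow m L i * ((p i).[z] / (p m.+1).[z]))
   <= r ^+ L * (X / (r ^+ L) ^+ 2 + Y).
  by move=> /le_trans; apply; rewrite ler_wpM2l ?(ltW rL) // lerD.
rewrite /X /Y mulr_suml -big_split /= mulr_sumr; apply: ler_sum => i _.
rewrite cabsM; set x := cabs _; set y := cabs _.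
have x0 : 0 <= x by exact: cabs_ge0.
have y0 : 0 <= y by exact: cabs_ge0.
set s := r ^+ L in rL *.
have -> : x * y = s * (x / s * y) by field; exact: lt0r_neq0.
rewrite ler_wpM2l ?(ltW rL) // -expr_div_n.
have : 0 <= x / s by rewrite divr_ge0 // ltW.
move: (x / s) => t t0; nra.
Qed.

Lemma ratio_le m : cabs (ratio m) <= b.
Proof.
rewrite cabsM cabsV ler_pdivrMr ?cabs_gt0 ?(p_neq0 p_on r0 Sr rz) //.
exact: (ratio_bound p_on r0 Sr rz).
Qed.

Definition back_ratio n d : Cplx R := (p (n - d)).[z] / (p n).[z].

Lemma back_ratioS n d : (d <= n)%N ->
  back_ratio n.+1 d.+1 = back_ratio n.+1 d * ratio (n - d).
Proof.
move=> dn; rewrite /back_ratio /ratio subSS (subSn dn).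
have h1 := p_neq0 p_on r0 Sr rz (n - d).+1; have h2 := p_neq0 p_on r0 Sr rz n.+1.
by field; rewrite h1 h2.
Qed.

Lemma back_ratio0 n : back_ratio n 0 = 1.
Proof. by rewrite /back_ratio subn0 divff // (p_neq0 p_on r0 Sr rz). Qed.

(** * Ratios at points far from the support *)

Hypothesis rz3 : 3 * r <= cabs z.

Lemma b_half : 0 <= b <= 1 / 2.
Proof.
have d0 : 0 < cabs z - r by rewrite subr_gt0.
apply/andP; split; first by rewrite divr_ge0 // ltW.
by rewrite /b ler_pdivrMr //; have := rz3; lra.
Qed.

Lemma back_ratio_le n d : (d <= n)%N -> cabs (back_ratio n d) <= b ^+ d.
Proof.
case: n => [|n]; first by rewrite leqn0 => /eqP ->; rewrite back_ratio0 cabs1.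
elim: d => [|d IH] dn; first by rewrite back_ratio0 cabs1.
rewrite back_ratioS // cabsM exprSr; apply: ler_pM; rewrite ?cabs_ge0 //.
- by apply: IH; exact: ltnW.
- exact: ratio_le.
Qed.

(** Consecutive values at least double, because [b] is at most one half. *)
Lemma sum_cabs_le m : \sum_(i < m.+1) cabs (p i).[z] <= 2 * cabs (p m).[z].
Proof.
elim: m => [|m IH].
  by rewrite big_ord_recr big_ord0 /= add0r mulr_natl mulr2n lerDl cabs_ge0.
rewrite big_ord_recr /=.
have := ratio_bound p_on r0 Sr rz m; rewrite -/b.
have /andP[b0 b1] := b_half.
have := cabs_ge0 (p m.+1).[z].
move: IH; set X := \sum_(i < _) _; set x := cabs _; set y := cabs _ => IH h1 h2.
have : b * y <= 1 / 2 * y by rewrite ler_wpM2r.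
lra.
Qed.

(** In the recurrence for z p_m the term with p_{m+1} must be balanced by the
    other ones, all of which are controlled by p_m. *)
Lemma ratio_ge m : cabs (H m.+1 m) / (cabs z + 2 * r) <= cabs (ratio m).
Proof.
have z0 : 0 < cabs z + 2 * r by have := r0; have := rz; lra.
have pm0 : 0 < cabs (p m.+1).[z] by rewrite cabs_gt0 (p_neq0 p_on r0 Sr rz).
rewrite /ratio cabsM cabsV ler_pdivrMr // mulrAC ler_pdivlMr // -cabsM.
have -> : H m.+1 m * (p m.+1).[z] =
    z * (p m).[z] - \sum_(i < m.+1) H i m * (p i).[z].
  by rewrite (recurrence p_on Sr) big_ord_recr /= addrC addrK.
apply: le_trans (cabsB _ _) _; rewrite cabsM mulrDr mulrC lerD2l.
apply: le_trans (cabs_sum _ _ _) _.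
rewrite mulrC -mulrA mulrCA.
apply: (@le_trans _ _ (r * \sum_(i < m.+1) cabs (p i).[z])).
  rewrite mulr_sumr; apply: ler_sum => i _; rewrite cabsM.
  by rewrite ler_wpM2r ?cabs_ge0 // (hess_le p_on r0 Sr).
by rewrite ler_wpM2l ?(ltW r0) // sum_cabs_le.
Qed.

(** The recurrence for z p_m divided by p_{m+1}: the terms beyond the first
    [D.+1] form a geometric tail of ratio at most one half. *)
Lemma truncated_recurrence m D : (D <= m)%N ->
  cabs (z * ratio m - \sum_(d < D.+1) H (m.+1 - d) m * back_ratio m.+1 d)
    <= 2 * r * b ^+ D.+1.
Proof.
move=> Dm; have pm := p_neq0 p_on r0 Sr rz m.+1.
have pm0 : 0 < cabs (p m.+1).[z] by rewrite cabs_gt0.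
have -> : z * ratio m - \sum_(d < D.+1) H (m.+1 - d) m * back_ratio m.+1 d =
   (\sum_(i < (m - D).+1) H i m * (p i).[z]) / (p m.+1).[z].
  rewrite /ratio mulrA (recurrence p_on Sr).
  have -> : \sum_(d < D.+1) H (m.+1 - d) m * back_ratio m.+1 d
     = (\sum_(d < D.+1) H (m.+1 - d) m * (p (m.+1 - d)).[z]) / (p m.+1).[z].
    by rewrite mulr_suml; apply: eq_bigr => d _; rewrite /back_ratio mulrA.
  rewrite -mulrBl; congr (_ / _); apply/eqP; rewrite subr_eq; apply/eqP.
  rewrite -(big_mkord xpredT (fun i => H i m * (p i).[z])).
  rewrite (big_cat_nat (n := (m - D).+1)) //=; last by lia.
  rewrite big_mkord; congr (_ + _).
  rewrite -{1}(addn0 (m - D).+1) addnC big_addn.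
  have -> : (m.+2 - (m - D).+1 = D.+1)%N by lia.
  rewrite big_mkord (reindex_inj rev_ord_inj) /=; apply: eq_bigr => d _.
  have -> : (D.+1 - d.+1 + (m - D).+1 = m.+1 - d)%N by have := ltn_ord d; lia.
  by [].
rewrite cabsM cabsV ler_pdivrMr //.
apply: le_trans (cabs_sum _ _ _) _.
apply: (@le_trans _ _ (r * \sum_(i < (m - D).+1) cabs (p i).[z])).
  rewrite mulr_sumr; apply: ler_sum => i _; rewrite cabsM.
  by rewrite ler_wpM2r ?cabs_ge0 // (hess_le p_on r0 Sr).
rewrite -!mulrA mulrCA ler_wpM2l ?(ltW r0) //.
apply: le_trans (sum_cabs_le _) _; rewrite ler_wpM2l //.
have := @back_ratio_le m.+1 D.+1 ltac:(lia).
by rewrite /back_ratio subSS cabsM cabsV ler_pdivrMr.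
Qed.

Lemma back_ratio_ge m D (a : R) : 0 < a -> (D <= m.+1)%N ->
  (forall d, (d < D)%N -> a <= cabs (H (m - d).+1 (m - d))) ->
  (a / (cabs z + 2 * r)) ^+ D <= cabs (back_ratio m.+1 D).
Proof.
move=> a0; have z0 : 0 < cabs z + 2 * r by have := r0; have := rz; lra.
elim: D => [|D IH] Dm ha; first by rewrite back_ratio0 cabs1.
rewrite back_ratioS // cabsM exprSr; apply: ler_pM.
- by rewrite exprn_ge0 // divr_ge0 // ltW.
- by rewrite divr_ge0 // ltW.
- by apply: IH => [|d dD]; [exact: ltnW|apply: ha; exact: ltnW].
- apply: le_trans (ratio_ge _); rewrite ler_pM2r ?invr_gt0 //; exact: ha.
Qed.

End TruncatedShift.

(** * Asymptotically equal sequences *)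

Section AsymptoticEquality.
Variable R : realType.
Implicit Types u v : nat -> Cplx R.

(** Boundedness is part of the notion so that it is stable under products. *)
Definition asymp_eq u v :=
  (exists B : R, \forall k \near \oo, cabs (u k) <= B /\ cabs (v k) <= B) /\
  (fun k => u k - v k) @ \oo --> (0 : Cplx R).

Lemma asymp_near u v u' v' :
  (\forall k \near \oo, u k = u' k /\ v k = v' k) -> asymp_eq u v -> asymp_eq u' v'.
Proof.
move=> e [[B hB] h]; split.
  by exists B; apply: filterS2 e hB => k [<- <-].
apply/cvgC0P => eps /((cvgC0P _).1 h); apply: filterS2 e => k [<- <-] //.
Qed.

Lemma asymp_cst (c : Cplx R) : asymp_eq (fun=> c) (fun=> c).
Proof.
split; first by exists (cabs c); near=> k.
by under eq_fun do rewrite subrr; exact: cvg_cst.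
Unshelve. all: by end_near. Qed.

Lemma asymp_add u v u' v' : asymp_eq u v -> asymp_eq u' v' ->
  asymp_eq (fun k => u k + u' k) (fun k => v k + v' k).
Proof.
move=> [[B hB] h] [[B' hB'] h']; split.
  exists (B + B'); near=> k.
  have [h1 h2] : cabs (u k) <= B /\ cabs (v k) <= B by near: k.
  have [h3 h4] : cabs (u' k) <= B' /\ cabs (v' k) <= B' by near: k.
  by split; (apply: le_trans (cabsD _ _) _; exact: lerD).
have -> : (fun k => u k + u' k - (v k + v' k)) =
    (fun k => u k - v k) \+ (fun k => u' k - v' k).
  by apply/funext => k /=; ring.
by rewrite -[0]addr0; exact: cvgD.
Unshelve. all: by end_near. Qed.

Lemma asymp_mul u v u' v' : asymp_eq u v -> asymp_eq u' v' ->
  asymp_eq (fun k => u k * u' k) (fun k => v k * v' k).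
Proof.
move=> [[B hB] h] [[B' hB'] h']; split.
  exists (B * B'); near=> k.
  have [h1 h2] : cabs (u k) <= B /\ cabs (v k) <= B by near: k.
  have [h3 h4] : cabs (u' k) <= B' /\ cabs (v' k) <= B' by near: k.
  by split; rewrite cabsM; apply: ler_pM; rewrite ?cabs_ge0.
apply/cvgC0P => e e0.
pose D := `|B| + `|B'| + 1.
have D0 : 0 < D by rewrite ltr_wpDl // addr_ge0.
have eD : 0 < e / (2 * D) by rewrite divr_gt0 // mulr_gt0.
have hu := (cvgC0P _).1 h _ eD; have hu' := (cvgC0P _).1 h' _ eD.
near=> k.
have [h1 h2] : cabs (u k) <= B /\ cabs (v k) <= B by near: k.
have [h3 h4] : cabs (u' k) <= B' /\ cabs (v' k) <= B' by near: k.
have k1 : cabs (u k - v k) < e / (2 * D) by near: k.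
have k2 : cabs (u' k - v' k) < e / (2 * D) by near: k.
have -> : u k * u' k - v k * v' k =
    (u k - v k) * u' k + v k * (u' k - v' k) by ring.
apply: le_lt_trans (cabsD _ _) _; rewrite !cabsM.
have w1 : cabs (u' k) < D.
  apply: le_lt_trans h3 _; rewrite /D.
  by have := ler_norm B'; have := normr_ge0 B; lra.
have w2 : cabs (v k) < D.
  apply: le_lt_trans h2 _; rewrite /D.
  by have := ler_norm B; have := normr_ge0 B'; lra.
have -> : e = e / (2 * D) * D + D * (e / (2 * D)) by field; exact: lt0r_neq0.
by apply: ltrD; apply: ltr_pM; rewrite ?cabs_ge0.
Unshelve. all: by end_near. Qed.

Lemma asymp_sum n (u v : 'I_n -> nat -> Cplx R) :
  (forall i, asymp_eq (u i) (v i)) ->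
  asymp_eq (fun k => \sum_(i < n) u i k) (fun k => \sum_(i < n) v i k).
Proof.
elim: n u v => [|n IH] u v h.
  under eq_fun do rewrite big_ord0.
  under [X in asymp_eq _ X]eq_fun do rewrite big_ord0.
  exact: asymp_cst.
under eq_fun do rewrite big_ord_recr.
under [X in asymp_eq _ X]eq_fun do rewrite big_ord_recr.
by apply: asymp_add (h _); apply: IH.
Qed.

End AsymptoticEquality.

(** At a point of modulus [t], the ratios are at most r / (t - r) and at least
    a / (t + 2 r).  As [t] grows the first bound tends to 0 while its quotient by
    the second stays bounded, so one more power of the first bound eventually
    makes it negligible against the second. *)
Lemma far_point (R : realType) (r a e r1 : R) (D : nat) :
  0 < r -> 0 < a -> 0 < e ->
  exists t, [/\ r < t, r1 < t, 3 * r <= t &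
    4 * r * (r / (t - r)) ^+ D.+1 < e / 2 * (a / (t + 2 * r)) ^+ D].
Proof.
move=> r0 a0 e0.
(* [5 r / (2 a)] is the bound on [b / g] for [3 r <= t] *)
pose K := 4 * r * (5 * r / (2 * a)) ^+ D.
have K0 : 0 < K by rewrite mulr_gt0 ?mulr_gt0 // exprn_gt0 // divr_gt0 ?mulr_gt0.
pose t := r + `|r1| + 3 * r + 2 * r * K / e.
have te : 0 < r * K / e by rewrite divr_gt0 // mulr_gt0.
have r10 := normr_ge0 r1; have r11 := ler_norm r1.
have rt : r < t by rewrite /t; lra.
have r3t : 3 * r <= t by rewrite /t; lra.
exists t; split=> //; first by rewrite /t; lra.
set b := r / (t - r); set g := a / (t + 2 * r).
have d0 : 0 < t - r by rewrite subr_gt0.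
have t2 : 0 < t + 2 * r by lra.
have b0 : 0 < b by rewrite divr_gt0.
have g0 : 0 < g by rewrite divr_gt0.
have bK : b * K < e / 2.
  rewrite /b mulrAC ltr_pdivrMr // /t.
  have -> : e / 2 * (r + `|r1| + 3 * r + 2 * r * K / e - r) =
      r * K + e / 2 * (`|r1| + 3 * r) by field; exact: lt0r_neq0.
  by rewrite ltrDl mulr_gt0 ?divr_gt0 //; lra.
have bg : b / g <= 5 * r / (2 * a).
  rewrite /b /g invf_div ler_pdivlMr ?mulr_gt0 //.
  have -> : r / (t - r) * ((t + 2 * r) / a) * (2 * a) =
      (2 * r * (t + 2 * r)) / (t - r) by field; rewrite !lt0r_neq0.
  by rewrite ler_pdivrMr //; move: r0 r3t; clear; nra.
rewrite -ltr_pdivrMr ?exprn_gt0 //; apply: le_lt_trans bK.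
have -> : 4 * r * b ^+ D.+1 / g ^+ D = b * (4 * r * (b / g) ^+ D).
  by move: (b) (g) => x y; rewrite exprS expr_div_n; ring.
rewrite /K ler_wpM2l ?(ltW b0) // ler_wpM2l ?mulr_ge0 ?(ltW r0) //.
by rewrite lerXn2r // nnegrE ?divr_ge0 ?mulr_ge0 ?ltW.
Qed.

(** * Convergence of ratios and convergence of matrix entries *)

Section RatioVersusEntries.
Variables (R : realType) (mu nu : {finite_measure set BorelC R -> \bar R}).
Variables p q : nat -> {poly Cplx R}.
Hypothesis p_on : orthonormal_polys mu p.
Hypothesis q_on : orthonormal_polys nu q.
Variable r : R.
Hypothesis r0 : 0 < r.
Hypothesis mur : forall z, msupp mu z -> cabs z <= r.
Hypothesis nur : forall z, msupp nu z -> cabs z <= r.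
Variables M M' : nat -> nat.
Hypothesis Moo : forall m, \forall k \near \oo, (m <= M k)%N.
Hypothesis Moo' : forall m, \forall k \near \oo, (m <= M' k)%N.
Local Notation H := (hess mu p).
Local Notation H' := (hess nu q).

Lemma hess_asymp (i j i' j' : nat -> nat) :
  (fun k => H (i k) (j k) - H' (i' k) (j' k)) @ \oo --> (0 : Cplx R) ->
  asymp_eq (fun k => H (i k) (j k)) (fun k => H' (i' k) (j' k)).
Proof.
move=> h; split=> //; exists r; near=> k.
by split; [exact: (hess_le p_on r0 mur)|exact: (hess_le q_on r0 nur)].
Unshelve. all: by end_near. Qed.

Section EntriesToRatios.
Hypothesis HM : forall d e,
  (fun k => H (M k - d) (M k - e) - H' (M' k - d) (M' k - e))
    @ \oo --> (0 : Cplx R).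
Hypothesis HM1 :
  (fun k => H (M k).+1 (M k) - H' (M' k).+1 (M' k)) @ \oo --> (0 : Cplx R).

(** By locality, the entries at a fixed distance from the corner are fixed
    polynomials in finitely many matrix entries near the corner. *)
Lemma trunc_pow_asymp l e :
  asymp_eq (fun k => trunc_pow mu p (M k) l (M k - e))
           (fun k => trunc_pow nu q (M' k) l (M' k - e)).
Proof.
elim: l e => [|l IH] e.
  apply: asymp_near (asymp_cst ((e == 0%N)%:R)); near=> k.
  have h1 : (e <= M k)%N by near: k; exact: Moo.
  have h2 : (e <= M' k)%N by near: k; exact: Moo'.
  by split; congr (_%:R); congr nat_of_bool; apply/eqP/eqP; lia.
pose F k := \sum_(d < e.+2)
  H (M k - e) (M k - d) * trunc_pow mu p (M k) l (M k - d).
pose F' k := \sum_(d < e.+2)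
  H' (M' k - e) (M' k - d) * trunc_pow nu q (M' k) l (M' k - d).
apply: (@asymp_near _ F F'); last first.
  by apply: asymp_sum => d; apply: asymp_mul (IH _); apply: hess_asymp; exact: HM.
near=> k.
have h1 : (e < M k)%N by near: k; exact: Moo.
have h2 : (e < M' k)%N by near: k; exact: Moo'.
rewrite /F /F' [in RHS]/trunc_pow iterS (trunc_apply_local p_on mur) //.
by split => //; rewrite [in RHS]/trunc_pow iterS (trunc_apply_local q_on nur).
Unshelve. all: by end_near. Qed.

(** The Neumann remainder is small uniformly in the size of the truncation, and
    the finitely many terms left are asymptotically equal. *)
Lemma entries_to_ratios z : r < cabs z ->
  (fun k => ratio p z (M k) - ratio q z (M' k)) @ \oo --> (0 : Cplx R).
Proof.
move=> rz; apply/cvgC0P => e e0.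
have z0 : 0 < cabs z by exact: lt_trans rz.
pose c := 1 + (r / (cabs z - r)) ^+ 2.
have c0 : 0 < c by rewrite ltr_pwDl // sqr_ge0.
have [L hL] : exists L, (r / cabs z) ^+ L * c < e / 3.
  have rz1 : `|r / cabs z| < 1.
    by rewrite ger0_norm ?divr_ge0 ?ltW // ltr_pdivrMr // mul1r.
  have ec : 0 < e / 3 / c by rewrite !divr_gt0.
  have [L _ /(_ L (leqnn L))] := (cvgr0Pnorm_lt _).1 (cvg_expr rz1) _ ec.
  rewrite /= ger0_norm ?exprn_ge0 ?divr_ge0 ?ltW // => h.
  by exists L; rewrite -ltr_pdivlMr.
pose S k := \sum_(l < L) z^-1 ^+ l.+1 *
  (H (M k).+1 (M k) * trunc_pow mu p (M k) l (M k)).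
pose S' k := \sum_(l < L) z^-1 ^+ l.+1 *
  (H' (M' k).+1 (M' k) * trunc_pow nu q (M' k) l (M' k)).
have [_ hS] : asymp_eq S S'.
  apply: asymp_sum => l; apply: asymp_mul (asymp_cst _) _; apply: asymp_mul.
    exact: hess_asymp.
  have := trunc_pow_asymp l 0; apply: asymp_near; near=> k; by rewrite !subn0.
have e30 : 0 < e / 3 by rewrite divr_gt0.
have hS3 := (cvgC0P _).1 hS _ e30.
near=> k.
have k1 : cabs (S k - S' k) < e / 3 by near: k.
have k2 := neumann_bound p_on r0 mur rz (M k) L.
have k3 := neumann_bound q_on r0 nur rz (M' k) L.
have -> : ratio p z (M k) - ratio q z (M' k) =
   (ratio p z (M k) - S k) - (ratio q z (M' k) - S' k) + (S k - S' k) by ring.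
apply: le_lt_trans (cabsD _ _) _.
have k4 := cabsB (ratio p z (M k) - S k) (ratio q z (M' k) - S' k).
rewrite -/c -/(S k) in k2; rewrite -/c -/(S' k) in k3.
lra.
Unshelve. all: by end_near. Qed.

End EntriesToRatios.

Section RatiosToEntries.
Variable r1 : R.
Hypothesis ratios : forall z, r1 < cabs z -> forall d,
  (fun k => ratio p z (M k - d) - ratio q z (M' k - d)) @ \oo --> (0 : Cplx R).
Variable a : R.
Hypothesis a0 : 0 < a.
Hypothesis Ha : \forall m \near \oo, a <= cabs (H m.+1 m).

Lemma back_ratio_asymp z d : r < cabs z -> r1 < cabs z ->
  asymp_eq (fun k => back_ratio p z (M k).+1 d)
           (fun k => back_ratio q z (M' k).+1 d).
Proof.
move=> rz r1z; elim: d => [|d IH].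
  apply: asymp_near (asymp_cst 1); near=> k.
  by rewrite (back_ratio0 p_on r0 mur rz) (back_ratio0 q_on r0 nur rz).
have hr : asymp_eq (fun k => ratio p z (M k - d)) (fun k => ratio q z (M' k - d)).
  split; last exact: ratios.
  exists (r / (cabs z - r)); near=> k.
  by split; [exact: (ratio_le p_on r0 mur)|exact: (ratio_le q_on r0 nur)].
apply: asymp_near (asymp_mul IH hr); near=> k.
have h1 : (d <= M k)%N by near: k; exact: Moo.
have h2 : (d <= M' k)%N by near: k; exact: Moo'.
by rewrite (back_ratioS p_on r0 mur rz) // (back_ratioS q_on r0 nur rz).
Unshelve. all: by end_near. Qed.

(** Strong induction on the distance [D] above the subdiagonal.  Divide the
    recurrence for z p_m by p_{m+1}: the terms at distance less than [D] agree
    asymptotically by induction, the quotient that multiplies the term at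
    distance [D] is at least of order |z|^{-D}, and the terms beyond it are
    O(|z|^{-D-1}), which is negligible for a suitable fixed point z. *)
Lemma ratios_to_entries D :
  (fun k => H ((M k).+1 - D) (M k) - H' ((M' k).+1 - D) (M' k))
    @ \oo --> (0 : Cplx R).
Proof.
elim/ltn_ind: D => D IH; apply/cvgC0P => e e0.
have [t [rt r1t r3t tail]] := far_point r1 D r0 a0 e0.
pose z : Cplx R := (t%:C)%C.
have zt : cabs z = t by rewrite cabs_real // ltW // (lt_trans r0).
rewrite -zt in rt r1t r3t tail.
have [rz r1z r3z] := And3 rt r1t r3t.
pose b := r / (cabs z - r); pose g := a / (cabs z + 2 * r).
have g0 : 0 < g by rewrite divr_gt0 //; have := r0; lra.
pose B n := back_ratio p z n; pose B' n := back_ratio q z n.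
have hB d := @back_ratio_asymp z d rz r1z.
have [_ hS] : asymp_eq
   (fun k => \sum_(d < D) H ((M k).+1 - d) (M k) * B (M k).+1 d)
   (fun k => \sum_(d < D) H' ((M' k).+1 - d) (M' k) * B' (M' k).+1 d).
  apply: asymp_sum => d; apply: asymp_mul (hB d); apply: hess_asymp.
  by apply: IH; exact: ltn_ord.
have hR := ratios r1z 0.
have [_ hBD] := hB D.
(* three differences smaller than [s], weighted by |z|, 1 and a matrix entry,
   use up the remaining half of the allowed error *)
pose s := e / 2 * g ^+ D / (1 + r + cabs z).
have s0 : 0 < s.
  by rewrite divr_gt0 ?mulr_gt0 ?divr_gt0 ?exprn_gt0 //; have := r0; lra.
have nS := (cvgC0P _).1 hS _ s0; have nR := (cvgC0P _).1 hR _ s0.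
have nB := (cvgC0P _).1 hBD _ s0.
have [m0 _ hm0] := Ha.
near=> k.
have h1 : (D <= M k)%N by near: k; exact: Moo.
have h2 : (D <= M' k)%N by near: k; exact: Moo'.
have h3 : (m0 + D <= M k)%N by near: k; exact: Moo.
have kS : cabs (\sum_(d < D) H ((M k).+1 - d) (M k) * B (M k).+1 d -
   \sum_(d < D) H' ((M' k).+1 - d) (M' k) * B' (M' k).+1 d) < s by near: k.
have kR : cabs (ratio p z (M k) - ratio q z (M' k)) < s.
  by near: k; apply: filterS nR => k; rewrite !subn0.
have kB : cabs (B (M k).+1 D - B' (M' k).+1 D) < s by near: k.
pose F := H ((M k).+1 - D) (M k); pose F' := H' ((M' k).+1 - D) (M' k).
set S := \sum_(d < D) H ((M k).+1 - d) (M k) * B (M k).+1 d in kS.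
set S' := \sum_(d < D) H' ((M' k).+1 - d) (M' k) * B' (M' k).+1 d in kS.
have T := truncated_recurrence p_on r0 mur rz r3z h1.
have T' := truncated_recurrence q_on r0 nur rz r3z h2.
rewrite big_ord_recr /= -/(B _ _) -/S -/F in T.
rewrite big_ord_recr /= -/(B' _ _) -/S' -/F' in T'.
rewrite -/b in T T'; rewrite -/F -/F'.
set x := ratio p z (M k) in kR T; set x' := ratio q z (M' k) in kR T'.
set y := B (M k).+1 D in kB T; set y' := B' (M' k).+1 D in kB T'.
have gy : g ^+ D <= cabs y.
  apply: (back_ratio_ge p_on r0 mur rz r3z a0) => [|d dD]; first exact: leqW.
  by apply: hm0; move: dD h3; clear; rewrite /=; lia.
have F'r : cabs F' <= r by exact: (hess_le q_on r0 nur).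
have E : (F - F') * y = z * (x - x') - (S - S')
    - ((z * x - (S + F * y)) - (z * x' - (S' + F' * y'))) - F' * (y - y') by ring.
have up : cabs ((F - F') * y) <= cabs z * s + s
    + (2 * r * b ^+ D.+1 + 2 * r * b ^+ D.+1) + r * s.
  rewrite E; apply: le_trans (cabsB _ _) _; apply: lerD; last first.
    by rewrite cabsM; apply: ler_pM; rewrite ?cabs_ge0 // ltW.
  apply: le_trans (cabsB _ _) _; apply: lerD; last first.
    by apply: le_trans (cabsB _ _) _; apply: lerD.
  apply: le_trans (cabsB _ _) _; apply: lerD; last exact: ltW.
  by rewrite cabsM; apply: ler_wpM2l; rewrite ?cabs_ge0 // ltW.
have gD : 0 < g ^+ D by rewrite exprn_gt0.
have sE : (1 + r + cabs z) * s = e / 2 * g ^+ D.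
  by rewrite /s mulrC divfK // lt0r_neq0 //; have := r0; lra.
rewrite cabsM in up.
rewrite -(ltr_pM2r gD).
apply: (@le_lt_trans _ _ (cabs (F - F') * cabs y)).
  by rewrite ler_wpM2l ?cabs_ge0.
apply: le_lt_trans up _.
by move: tail sE; rewrite -/b -/g; move: (cabs z) => w; lra.
Unshelve. all: by end_near. Qed.

End RatiosToEntries.
End RatioVersusEntries.

(** * Extraction of subsequences *)

Section SequentialCompactness.
Variable R : realType.

Lemma strictly_increasing_ge s : strictly_increasing s -> forall k, (k <= s k)%N.
Proof.
move=> hs; elim=> [|k IH] //; apply: leq_ltn_trans IH _; exact: hs.
Qed.

Lemma strictly_increasing_near s c : strictly_increasing s ->
  \forall k \near \oo, (c <= s k)%N.
Proof.
move=> hs; exists c => // k /= ck.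
exact: leq_trans ck (strictly_increasing_ge hs k).
Qed.

Lemma strictly_increasing_comp s t :
  strictly_increasing s -> strictly_increasing t -> strictly_increasing (s \o t).
Proof. by move=> hs ht a b ab; apply/hs/ht. Qed.

Lemma near_subseq s (P : nat -> Prop) : strictly_increasing s ->
  (\forall k \near \oo, P k) -> \forall k \near \oo, P (s k).
Proof.
move=> hs [c _ hc]; apply: filterS (strictly_increasing_near c hs) => k; exact: hc.
Qed.

Lemma strictly_increasing_choice (P : nat -> nat -> Prop) :
  (forall t K, exists2 k, (K <= k)%N & P t k) ->
  exists2 s, strictly_increasing s & forall t, P t (s t).
Proof.
move=> h; have {}h t K : exists k, (K <= k)%N /\ P t k.
  by have [k] := h t K; exists k.
pose f t K := projT1 (cid (h t K)).
have fP t K : (K <= f t K)%N /\ P t (f t K) := projT2 (cid (h t K)).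
pose s := fix s t := if t is t'.+1 then f t (s t').+1 else f 0 0.
exists s; last by case=> [|t]; [case: (fP 0%N 0%N)|case: (fP t.+1 (s t).+1)].
by apply: homo_ltn => [y x z|t]; [exact: ltn_trans|case: (fP t.+1 (s t).+1)].
Qed.

Lemma ultra_bounded_cvg (G : set_system nat) (u : nat -> R) (B : R) :
  UltraFilter G -> (forall k, `|u k| <= B) ->
  exists l, forall e, 0 < e -> G [set k | `|u k - l| < e].
Proof.
move=> GU uB; have GP := @ultra_proper _ _ GU.
have [] := @segment_compact R (- B) B (u @ G) _.
  by apply: (@filterE _ G) => k; rewrite /= in_itv /= -ler_norml; exact: uB.
move=> l [_ cl]; exists l => e e0.
have [//|nG] := @in_ultra_setVsetC _ G [set k | `|u k - l| < e] GU.
have [||x [nx lx]] := cl [set x | ~ (`|x - l| < e)] (ball l e).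
- exact: nG.
- exact: nbhsx_ballx.
by exfalso; apply: nx; rewrite /= distrC.
Qed.

(** Instead of a diagonal argument: along an ultrafilter finer than [\oo] every
    bounded sequence converges, so all limits [l t] exist at once.  The set of
    indices at which the first [d] sequences are close to their limits belongs
    to the ultrafilter, hence is infinite, and the [d]-th index is chosen in it. *)
Lemma bounded_subseq (T : countType) (u : T -> nat -> Cplx R) (B : R) :
  (forall t k, cabs (u t k) <= B) ->
  exists2 s, strictly_increasing s &
  exists l : T -> Cplx R, forall t, (u t \o s) @ \oo --> l t.
Proof.
move=> uB; have [G [GU ooG]] := ultraFilterLemma eventually_filter.
have GP := @ultra_proper _ _ GU.
have re t : exists l, forall e, 0 < e -> G [set k | `|complex.Re (u t k) - l| < e].
  by apply: (ultra_bounded_cvg GU) => k; apply: le_trans (Re_le_cabs _) (uB t k).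
have im t : exists l, forall e, 0 < e -> G [set k | `|complex.Im (u t k) - l| < e].
  by apply: (ultra_bounded_cvg GU) => k; apply: le_trans (Im_le_cabs _) (uB t k).
pose l t : Cplx R := (projT1 (cid (re t)) +i* projT1 (cid (im t)))%C.
have lG t e : 0 < e -> G [set k | cabs (u t k - l t) < e].
  move=> e0; have e20 : 0 < e / 2 by rewrite divr_gt0.
  have := projT2 (cid (im t)) _ e20.
  apply: filterS2 (projT2 (cid (re t)) _ e20) => k /= h1 h2.
  apply: le_lt_trans (cabs_le_ReIm _) _; rewrite (splitr e).
  by case: (u t k) h1 h2 => x y h1 h2; apply: ltrD.
pose close d j k := forall t, (pickle t < j)%N -> cabs (u t k - l t) < d.+1%:R^-1.
have near_all d : G (close d d).
  have hd : 0 < d.+1%:R^-1 :> R by rewrite invr_gt0.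
  suff: forall j, G (close d j) by [].
  elim=> [|j IH]; first by apply: filterE => k t.
  case e: (@unpickle T j) => [t|].
    apply: filterS2 IH (lG t _ hd) => k /= h1 h2 t'.
    rewrite ltnS leq_eqVlt => /orP[/eqP tj|]; last exact: h1.
    by move: e; rewrite -tj pickleK => -[->].
  apply: filterS IH => k /= h1 t'.
  rewrite ltnS leq_eqVlt => /orP[/eqP tj|]; last exact: h1.
  by move: e; rewrite -tj pickleK.
have [|s hs sP] := @strictly_increasing_choice (fun d => close d d).
  move=> d K; have : G ([set k | (K <= k)%N] `&` close d d).
    by apply: filterI (near_all d); apply: ooG; exists K.
  by move=> /filter_ex[k [Kk hk]]; exists k.
exists s => //; exists l => t; apply/cvgCP => e e0.
have [n ne] := ltr_add_invr e0; rewrite add0r in ne.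
near=> d; apply: lt_trans ne; apply: lt_le_trans (sP d t _) _.
  by near: d; exact: nbhs_infty_gt.
by rewrite lef_pV2 ?posrE // ler_nat ltnS; near: d; exact: nbhs_infty_ge.
Unshelve. all: by end_near. Qed.

End SequentialCompactness.

(** * Right limits *)

Section RightLimits.
Variable R : realType.
Implicit Types (A B : nat -> nat -> Cplx R) (X : int -> int -> Cplx R).
Implicit Types n m s : nat -> nat.

Lemma cvg_mxP a b (F : nat -> 'M[Cplx R]_(a, b)) (L : 'M[Cplx R]_(a, b)) :
  (F @ \oo --> L) <-> (forall i j, (fun k => F k i j) @ \oo --> L i j).
Proof.
have FF := fmap_filter F eventually_filter.
split=> h.
  move=> i j; apply/cvg_entourageP => E entE.
  have := (@cvg_mx_entourageP _ a b (F @ \oo) FF L).1 h E entE.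
  pose P k := forall i j, (L i j, F k i j) \in E.
  by apply: (@filterS _ eventually _ P) => k /(_ i j); rewrite inE.
apply/(@cvg_mx_entourageP _ a b (F @ \oo) FF L) => E entE.
apply: filter_forall => i; apply: filter_forall => j.
have FFij := fmap_filter (fun k => F k i j) eventually_filter.
have := (@cvg_entourageP _ ((fun k => F k i j) @ \oo) FFij (L i j)).1 (h i j) E entE.
pose P k := E (L i j, F k i j).
by apply: (@filterS _ eventually _ P) => k Pk; apply/mem_set.
Qed.

(** Every pair of integer offsets is of the form [i - c], [j - c], so a right
    limit is the same thing as convergence along each pair of fixed offsets. *)
Lemma approachesP A X n : strictly_increasing n ->
  approaches A X n <->
  (forall i j c : nat, (fun k => A (n k + i - c)%N (n k + j - c)%N) @ \oo -->
     X (i%:Z - c%:Z) (j%:Z - c%:Z)).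
Proof.
move=> hn; split=> [h i j c|h c]; last first.
  apply/cvg_mxP => i j; rewrite mxE.
  by under eq_fun do rewrite mxE; exact: h.
(* the offsets [i - c] and [j - c] occur in every block of half-width [c'] *)
pose c' := (c + i + j)%N.
have i'c : (i + i + j < c'.*2.+1)%N by rewrite /c'; lia.
have j'c : (i + j + j < c'.*2.+1)%N by rewrite /c'; lia.
have := (cvg_mxP _ _).1 (h c') (Ordinal i'c) (Ordinal j'c).
rewrite mxE /=; under eq_fun do rewrite mxE /=.
have -> : (i + i + j)%N%:Z - c'%:Z = i%:Z - c%:Z by rewrite /c'; lia.
have -> : (i + j + j)%N%:Z - c'%:Z = j%:Z - c%:Z by rewrite /c'; lia.
have e k a : (n k + (i + a + j) - c' = n k + a - c)%N by rewrite /c'; lia.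
by under eq_fun do rewrite !e.
Qed.

(** Both sides of the equivalence are shown to amount to this condition.  The
    offsets [i - c] and [j - c] run through all integers. *)
Definition entries_match A B n m := forall i j c : nat,
  (fun k => A (n k + i - c)%N (n k + j - c)%N - B (m k + i - c)%N (m k + j - c)%N)
    @ \oo --> (0 : Cplx R).

Lemma cvg_subseq s (u : nat -> Cplx R) (l : Cplx R) : strictly_increasing s ->
  u @ \oo --> l -> (u \o s) @ \oo --> l.
Proof. by move=> hs /cvgCP h; apply/cvgCP => e /h; exact: near_subseq. Qed.

Lemma entries_match_same A B n m : strictly_increasing n -> strictly_increasing m ->
  entries_match A B n m -> same_right_limits_through A B n m.
Proof.
move=> hn hm h s hs X.
have hns := strictly_increasing_comp hn hs.
have hms := strictly_increasing_comp hm hs.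
split=> [/(approachesP _ _ hns) H|/(approachesP _ _ hms) H].
  apply/(approachesP _ _ hms) => i j c.
  have := cvgC_sub (H i j c) (cvg_subseq hs (h i j c)); rewrite subr0.
  by apply: cvgC_near; apply: nearW => k /=; ring.
apply/(approachesP _ _ hns) => i j c.
have := cvgC_add (H i j c) (cvg_subseq hs (h i j c)); rewrite addr0.
by apply: cvgC_near; apply: nearW => k /=; ring.
Qed.

(** The diagonals at the countably many pairs of offsets are bounded sequences. *)
Lemma right_limit_exists A n (b : R) : (forall i j, cabs (A i j) <= b) ->
  strictly_increasing n ->
  exists2 s, strictly_increasing s & exists X, approaches A X (n \o s).
Proof.
move=> Ab hn.
have [|s hs [l hl]] := @bounded_subseq R (int * int)%type
   (fun t k => A (absz ((n k)%:Z + t.1)) (absz ((n k)%:Z + t.2))) b; first by [].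
exists s => //; exists (fun i j => l (i, j)).
apply/(approachesP _ _ (strictly_increasing_comp hn hs)) => i j c.
apply: cvgC_near (hl (i%:Z - c%:Z, j%:Z - c%:Z)); near=> k => /=.
have h : (c <= n (s k))%N.
  by near: k; exact: (strictly_increasing_near c (strictly_increasing_comp hn hs)).
by congr A; lia.
Unshelve. all: by end_near. Qed.

Lemma not_cvg0_subseq (u : nat -> Cplx R) : ~ (u @ \oo --> (0 : Cplx R)) ->
  exists e, 0 < e /\ exists2 s, strictly_increasing s & forall k, e <= cabs (u (s k)).
Proof.
move=> /cvgC0P /existsNP[e /not_implyP[e0 ne]]; exists e; split=> //.
apply: (@strictly_increasing_choice (fun _ k => e <= cabs (u k))) => _ K.
apply: contrapT => h; apply: ne; exists K => // k /= Kk.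
by rewrite ltNge; apply/negP => ek; apply: h; exists k.
Qed.

(** If the difference stayed away from 0 along a subsequence, a further
    subsequence would have a right limit, common to both matrices. *)
Lemma same_entries_match A B n m (b : R) : (forall i j, cabs (A i j) <= b) ->
  strictly_increasing n -> strictly_increasing m ->
  same_right_limits_through A B n m -> entries_match A B n m.
Proof.
move=> Ab hn hm h i j c; apply: contrapT => /not_cvg0_subseq[e [e0 [s hs es]]].
have hns := strictly_increasing_comp hn hs.
have hms := strictly_increasing_comp hm hs.
have [t ht [X AX]] := right_limit_exists Ab hns.
have hst := strictly_increasing_comp hs ht.
have BX := (h _ hst X).1 AX.
have h1 := (approachesP _ _ (strictly_increasing_comp hns ht)).1 AX i j c.
have h2 := (approachesP _ _ (strictly_increasing_comp hms ht)).1 BX i j c.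
have := cvgC_sub h1 h2; rewrite subrr => /cvgC0P /(_ _ e0).
move=> [K _ /(_ K (leqnn K))] /=.
by rewrite ltNge es.
Qed.

(** A bounded matrix has a right limit along some refinement of any subsequence,
    so its entries tend to 0 at all offsets as soon as 0 is the only right limit. *)
Lemma entries_match_unique A B (b : R) : (forall i j, cabs (A i j - B i j) <= b) ->
  entries_match A B id id <->
  unique (right_limit (fun i k => A i k - B i k)) (fun _ _ => 0).
Proof.
move=> Db; have hid : strictly_increasing id by [].
split=> [h|[_ U] i j c].
  split; first by exists id => //; apply/approachesP.
  move=> X [n hn /(approachesP _ _ hn) hX]; apply/funext => x; apply/funext => y.
  pose c := (absz x + absz y)%N.
  pose i := absz (c%:Z + x); pose j := absz (c%:Z + y).
  have ex : i%:Z - c%:Z = x by rewrite /i /c; lia.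
  have ey : j%:Z - c%:Z = y by rewrite /j /c; lia.
  have := hX i j c; rewrite ex ey => hX1.
  have h1 := cvg_subseq hn (h i j c).
  exact: (cvg_unique _ h1 hX1).
apply: contrapT => /not_cvg0_subseq[e [e0 [s hs es]]].
have [t ht [X AX]] := right_limit_exists Db hs.
have hst := strictly_increasing_comp hs ht.
have X0 : (fun _ _ => 0) = X by apply: U; exists (s \o t).
have := (approachesP _ _ hst).1 AX i j c; rewrite -X0.
move=> /cvgC0P /(_ _ e0) [K _ /(_ K (leqnn K))] /=.
by rewrite ltNge es.
Qed.

End RightLimits.

(** * The radius of the support and the ratios of leading coefficients *)

Section SupportRadius.
Variables (R : realType) (mu : {finite_measure set BorelC R -> \bar R}).
Hypothesis mu_compact : compact (msupp mu).

Lemma cabs_continuous : continuous (fun z : Cplx R => cabs z : R).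
Proof.
have tri (x y : Cplx R) : cabs x <= cabs (x - y) + cabs y.
  by apply: le_trans (cabsD _ _); rewrite subrK.
apply: contraction_continuous => v w; have := tri v w; have := tri w v.
by rewrite (cabsBC w v) ler_norml => ? ?; apply/andP; split; lra.
Qed.

Lemma msupp_le_mradius z : msupp mu z -> cabs z <= mradius mu.
Proof.
move=> Sz; apply: ub_le_sup; last by exists z.
have cc : compact [set cabs z | z in msupp mu].
  apply: continuous_compact mu_compact; apply: continuous_subspaceT.
  exact: cabs_continuous.
have [B [_ hB]] := compact_bounded cc.
exists (B + 1) => x xS; apply: le_trans (ler_norm x) _.
by apply: (hB (B + 1)); rewrite ?ltrDl.
Qed.

Lemma mradius_ge0 : infinite_set (msupp mu) -> 0 <= mradius mu.
Proof.
by move=> /infinite_setN0[z Sz]; exact: le_trans (cabs_ge0 z) (msupp_le_mradius Sz).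
Qed.

End SupportRadius.

Lemma kappa_ratio_lower_bound (R : realType) (p : nat -> {poly Cplx R}) :
  kappa_ratio_liminf_pos p ->
  exists2 a : R, 0 < a & \forall m \near \oo, a <= kappa p m / kappa p m.+1.
Proof.
rewrite /kappa_ratio_liminf_pos; set u := fun n => _.
have -> : limn_einf u = ereal_sup (range (einfs u)).
  by rewrite limn_einf_lim; apply/cvg_lim => //; exact: cvg_einfs_sup.
move=> /ereal_sup_gt[_ [n _ <-]]; rewrite /einfs /= => e0.
have le m : (n <= m)%N -> (ereal_inf (sdrop u n) <= u m)%E.
  by move=> nm; apply: ereal_inf_lbound; exists m.
move: e0 le; case: (ereal_inf _) => [a| |] //= a0 le.
  by exists a; [rewrite -lte_fin|exists n => // m /= /le; rewrite lee_fin].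
by have := le n (leqnn n).
Qed.

(** * The equivalence *)

Lemma bergman_hess (R : realType)
    (mu : {finite_measure set BorelC R -> \bar R}) p i k :
  bergman_shift mu p i k = hess mu p i.-1 k.-1.
Proof. by []. Qed.

Section Equivalence.
Variables (R : realType) (mu nu : {finite_measure set BorelC R -> \bar R}).
Hypothesis mu_compact : compact (msupp mu).
Hypothesis mu_infinite : infinite_set (msupp mu).
Hypothesis nu_compact : compact (msupp nu).
Variables p q : nat -> {poly Cplx R}.
Hypothesis p_on : orthonormal_polys mu p.
Hypothesis q_on : orthonormal_polys nu q.
Variables n m : nat -> nat.
Hypothesis n_inc : strictly_increasing n.
Hypothesis m_inc : strictly_increasing m.
Local Notation Rmax := (Num.max (mradius mu) (mradius nu)).
Local Notation A := (bergman_shift mu p).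
Local Notation B := (bergman_shift nu q).

Lemma Rmax_ge0 : 0 <= Rmax.
Proof. by rewrite le_max mradius_ge0. Qed.

Lemma mu_le_Rmax z : msupp mu z -> cabs z <= Rmax.
Proof. by move=> /(msupp_le_mradius mu_compact) h; rewrite le_max h. Qed.

Lemma nu_le_Rmax z : msupp nu z -> cabs z <= Rmax.
Proof. by move=> /(msupp_le_mradius nu_compact) h; rewrite le_max h orbT. Qed.

(** The absolute value only serves to land in [nat]: along a strictly increasing
    sequence the argument is nonnegative for large [k]. *)
Definition shift_idx (s : nat -> nat) (c : int) (k : nat) : nat :=
  absz ((s k)%:Z + c).

Lemma shiftB s c d k : (absz c + d <= s k)%N ->
  shift_idx s (c - d%:Z) k = (shift_idx s c k - d)%N.
Proof. by rewrite /shift_idx; clear; lia. Qed.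

Lemma shift_pred s c i t k : i%:Z = t%:Z + c + 1 -> (t < s k)%N ->
  shift_idx s c k = (s k + i - t).-1.
Proof. by rewrite /shift_idx; clear; lia. Qed.

Lemma shiftS s c k : (absz c <= s k)%N ->
  shift_idx s (c + 1) k = (shift_idx s c k).+1.
Proof. by rewrite /shift_idx; clear; lia. Qed.

Lemma shift_near s c d : strictly_increasing s ->
  \forall k \near \oo, (d <= shift_idx s c k)%N.
Proof.
move=> hs; apply: filterS (strictly_increasing_near (d + absz c) hs) => k.
by rewrite /shift_idx; lia.
Qed.

Lemma ratio_shift z j :
  (fun k => (zpoly p ((n k)%:Z + j - 1)).[z] / (zpoly p ((n k)%:Z + j)).[z]
       - (zpoly q ((m k)%:Z + j - 1)).[z] / (zpoly q ((m k)%:Z + j)).[z])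
    @ \oo --> (0 : Cplx R)
  <-> (fun k => ratio p z (shift_idx n (j - 1) k)
                - ratio q z (shift_idx m (j - 1) k))
    @ \oo --> (0 : Cplx R).
Proof.
have E : \forall k \near \oo,
   (zpoly p ((n k)%:Z + j - 1)).[z] / (zpoly p ((n k)%:Z + j)).[z]
       - (zpoly q ((m k)%:Z + j - 1)).[z] / (zpoly q ((m k)%:Z + j)).[z]
   = ratio p z (shift_idx n (j - 1) k) - ratio q z (shift_idx m (j - 1) k).
  have e g s k : (absz j + 1 <= s k)%N ->
     (zpoly g ((s k)%:Z + j - 1)).[z] / (zpoly g ((s k)%:Z + j)).[z]
     = ratio g z (shift_idx s (j - 1) k).
    move=> h; have -> : (s k)%:Z + j = (shift_idx s (j - 1) k).+1.
      by rewrite /shift_idx; move: h; clear; lia.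
    by have -> : Posz (shift_idx s (j - 1) k).+1 - 1 = shift_idx s (j - 1) k by lia.
  near=> k; rewrite !e //; near: k; exact: strictly_increasing_near.
split; apply: cvgC_near => //.
by apply: filterS E => k ->.
Unshelve. all: by end_near. Qed.

Lemma match_shift c d : entries_match A B n m ->
  (fun k => hess mu p (shift_idx n c k) (shift_idx n d k)
            - hess nu q (shift_idx m c k) (shift_idx m d k))
    @ \oo --> (0 : Cplx R).
Proof.
move=> h; pose t := (absz c + absz d)%N.
(* the extra 1 accounts for the numbering of rows and columns from 1 *)
have [i ei] : exists i : nat, i%:Z = t%:Z + c + 1.
  by exists (absz (t%:Z + c + 1)); rewrite /t; clear; lia.
have [j ej] : exists i : nat, i%:Z = t%:Z + d + 1.
  by exists (absz (t%:Z + d + 1)); rewrite /t; clear; lia.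
apply: cvgC_near (h i j t); near=> k.
have hn : (t < n k)%N by near: k; exact: strictly_increasing_near.
have hm : (t < m k)%N by near: k; exact: strictly_increasing_near.
rewrite !bergman_hess (shift_pred ei hn) (shift_pred ej hn).
by rewrite (shift_pred ei hm) (shift_pred ej hm).
Unshelve. all: by end_near. Qed.

Lemma match_to_ratio :
  entries_match A B n m -> ratio_asymptotics_through mu nu p q n m.
Proof.
move=> h z Rz j; apply/ratio_shift.
pose r := (Rmax + cabs z) / 2.
have R0 := Rmax_ge0.
have r0 : 0 < r by rewrite /r; lra.
have Rr : Rmax <= r by rewrite /r; lra.
have rz : r < cabs z by rewrite /r; lra.
apply: (entries_to_ratios p_on q_on r0 _ _ _ _ _ _ rz).
- by move=> w /mu_le_Rmax /le_trans; apply.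
- by move=> w /nu_le_Rmax /le_trans; apply.
- by move=> d; exact: shift_near.
- by move=> d; exact: shift_near.
- move=> d e; apply: cvgC_near (match_shift (j - 1 - d%:Z) (j - 1 - e%:Z) h).
  near=> k.
  have hn : (absz (j - 1) + (d + e) <= n k)%N.
    by near: k; exact: strictly_increasing_near.
  have hm : (absz (j - 1) + (d + e) <= m k)%N.
    by near: k; exact: strictly_increasing_near.
  rewrite addnA in hn hm.
  have [hnd hne] : (absz (j - 1) + d <= n k)%N /\ (absz (j - 1) + e <= n k)%N.
    by move: hn; clear; lia.
  have [hmd hme] : (absz (j - 1) + d <= m k)%N /\ (absz (j - 1) + e <= m k)%N.
    by move: hm; clear; lia.
  by rewrite (shiftB hnd) (shiftB hne) (shiftB hmd) (shiftB hme).
- apply: cvgC_near (match_shift (j - 1 + 1) (j - 1) h); near=> k.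
  have hn : (absz (j - 1) <= n k)%N by near: k; exact: strictly_increasing_near.
  have hm : (absz (j - 1) <= m k)%N by near: k; exact: strictly_increasing_near.
  by rewrite (shiftS hn) (shiftS hm).
Unshelve. all: by end_near. Qed.

Lemma ratio_to_match : kappa_ratio_liminf_pos p ->
  ratio_asymptotics_through mu nu p q n m -> entries_match A B n m.
Proof.
move=> /kappa_ratio_lower_bound[a a0 ha] h i j c.
have R0 := Rmax_ge0.
pose r := Rmax + 1.
have r0 : 0 < r by rewrite /r; lra.
have mur w : msupp mu w -> cabs w <= r by move=> /mu_le_Rmax; rewrite /r; lra.
have nur w : msupp nu w -> cabs w <= r by move=> /nu_le_Rmax; rewrite /r; lra.
(* strictly below the subdiagonal both entries vanish *)
have [ji|ij] := ltnP j.+1 i.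
  apply: (@cvgC_near _ (fun=> 0)); last exact: cvg_cst; near=> k.
  have hn : (c < n k)%N by near: k; exact: strictly_increasing_near.
  have hm : (c < m k)%N by near: k; exact: strictly_increasing_near.
  rewrite !bergman_hess (hess_eq0 p_on mur); last by move: ji hn; clear; lia.
  by rewrite (hess_eq0 q_on nur) ?subr0 //; move: ji hm; clear; lia.
pose J := j%:Z - c%:Z - 1.
have ratios z : Rmax < cabs z -> forall d,
    (fun k => ratio p z (shift_idx n J k - d) - ratio q z (shift_idx m J k - d))
      @ \oo --> (0 : Cplx R).
  move=> Rz d; apply: cvgC_near ((ratio_shift z (J - d%:Z + 1)).1 (h z Rz _)).
  near=> k.
  have hn : (absz J + d <= n k)%N by near: k; exact: strictly_increasing_near.
  have hm : (absz J + d <= m k)%N by near: k; exact: strictly_increasing_near.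
  by rewrite addrK (shiftB hn) (shiftB hm).
have ha' : \forall k \near \oo, a <= cabs (hess mu p k.+1 k).
  by apply: filterS ha => k; rewrite (cabs_hess_subdiag p_on mur).
have nJ d : \forall k \near \oo, (d <= shift_idx n J k)%N by exact: shift_near.
have mJ d : \forall k \near \oo, (d <= shift_idx m J k)%N by exact: shift_near.
have := ratios_to_entries p_on q_on r0 mur nur nJ mJ ratios a0 ha' (j.+1 - i).
apply: cvgC_near.
have idx s k : (c + i + j + 1 <= s k)%N ->
    ((shift_idx s J k).+1 - (j.+1 - i) = (s k + i - c).-1 /\
     shift_idx s J k = (s k + j - c).-1)%N.
  by rewrite /shift_idx /J; move: ij; clear; lia.
near=> k.
have hn : (c + i + j + 1 <= n k)%N by near: k; exact: strictly_increasing_near.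
have hm : (c + i + j + 1 <= m k)%N by near: k; exact: strictly_increasing_near.
by rewrite !bergman_hess; have [-> ->] := idx n k hn; have [-> ->] := idx m k hm.
Unshelve. all: by end_near. Qed.

Lemma bergman_bounded :
  exists b, forall i j, cabs (A i j) <= b /\ cabs (B i j) <= b.
Proof.
have R0 := Rmax_ge0.
exists (Rmax + 1) => i j.
have r0 : 0 < Rmax + 1 by lra.
split.
- by apply: (hess_le p_on r0) => w /mu_le_Rmax; lra.
- by apply: (hess_le q_on r0) => w /nu_le_Rmax; lra.
Qed.

End Equivalence.

Theorem corollary1p3 (R : realType)
    (mu nu : {finite_measure set BorelC R -> \bar R})
    (mu_compact : compact (msupp mu)) (mu_infinite : infinite_set (msupp mu))
    (nu_compact : compact (msupp nu)) (nu_infinite : infinite_set (msupp nu))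
    (p q : nat -> {poly Cplx R})
    (p_orthonormal : orthonormal_polys mu p)
    (q_orthonormal : orthonormal_polys nu q) :
  (kappa_ratio_liminf_pos p -> kappa_ratio_liminf_pos q ->
     (forall n m : nat -> nat, strictly_increasing n -> strictly_increasing m ->
        (ratio_asymptotics_through mu nu p q n m <->
         same_right_limits_through (bergman_shift mu p) (bergman_shift nu q) n m))
     /\
     (ratio_asymptotics mu nu p q <->
      unique
        (right_limit (fun i k => bergman_shift mu p i k - bergman_shift nu q i k))
        (fun _ _ => 0)))
  /\
  (forall n m : nat -> nat, strictly_increasing n -> strictly_increasing m ->
     same_right_limits_through (bergman_shift mu p) (bergman_shift nu q) n m ->
     ratio_asymptotics_through mu nu p q n m).
Proof.
have bounded := bergman_bounded mu_compact mu_infinite nu_compact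
  p_orthonormal q_orthonormal.
have fwd n m : strictly_increasing n -> strictly_increasing m ->
    same_right_limits_through (bergman_shift mu p) (bergman_shift nu q) n m ->
    ratio_asymptotics_through mu nu p q n m.
  move=> hn hm /(same_entries_match _ hn hm) h.
  have [b hb] := bounded.
  apply: match_to_ratio => //; apply: (h b) => i j; exact: (hb i j).1.
split=> // hp hq; split=> [n m hn hm|].
  split=> [h|]; last exact: fwd.
  by apply: entries_match_same => //; exact: ratio_to_match.
have hid : strictly_increasing id by [].
have [b hb] := bounded.
pose matching := entries_match (bergman_shift mu p) (bergman_shift nu q) id id.
apply: (iff_trans (B := matching)).
  by split=> h; [exact: ratio_to_match|exact: match_to_ratio].
apply: (@entries_match_unique _ _ _ (b + b)) => i j.
apply: le_trans (cabsB _ _) _; apply: lerD; [exact: (hb i j).1|exact: (hb i j).2].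
Qed.
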